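(* Let $1\le p<2$. There are constants $c_0,c_1,c_2,c_3>0$ such that for all $n,N\in\mathbb{N}$ with $c_0\sqrt{N}\le n\le c_1 N$, $$ c_2\, n^{-2/p}N^{2/p-1}\le e_n^q(S_N,\mathcal{B}_p^N)\le c_3\, n^{-2/p}N^{2/p-1}\max\big(\log(n/\sqrt{N}),1\big)^{2/p-1}. $$
   Context: Throughout, $\log=\log_2$, $\mathbb{N}=\{1,2,\dots\}$, $\mathbb{N}_0=\mathbb{N}\cup\{0\}$, and $\mathbb{Z}[0,N)=\{0,\dots,N-1\}$. Quantum model. Let $D,K$ be nonempty sets, $F$ a nonempty set of functions $D\to K$, $G$ a normed space over $\mathbb{R}$ or $\mathbb{C}$, and $S:F\to G$. Let $H_m=(\mathbb{C}^2)^{\otimes m}$ with canonical basis $|i\rangle$, $i\in\mathbb{Z}[0,2^m)$ (via binary expansion). A quantum query is a tuple $Q=(m,m',m'',Z,\tau,\beta)$ with $m,m',m''\in\mathbb{N}$, $m'+m''\le m$, $\emptyset\ne Z\subseteq\mathbb{Z}[0,2^{m'})$, $\tau:Z\to D$, $\beta:K\to\mathbb{Z}[0,2^{m''})$. For $f\in F$ the unitary $Q_f$ on $H_m=H_{m'}\otimes H_{m''}\otimes H_{m-m'-m''}$ is given on basis states by $Q_f|i\rangle|x\rangle|y\rangle=|i\rangle|x\oplus\beta(f(\tau(i)))\rangle|y\rangle$ if $i\in Z$ and $Q_f|i\rangle|x\rangle|y\rangle=|i\rangle|x\rangle|y\rangle$ otherwise, where $\oplus$ is addition mod $2^{m''}$.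 A quantum algorithm with no measurement is $(Q,(U_j)_{j=0}^n)$ with $n\in\mathbb{N}_0$ and unitaries $U_j$ on $H_{m}$, $m=m(Q)$; it defines $A_f=U_nQ_fU_{n-1}\cdots U_1Q_fU_0$ and uses $n$ queries; $A_f(x,y)$ denotes its matrix entries in the canonical basis. A quantum algorithm from $F$ to $G$ with $k\in\mathbb{N}$ measurements is $A=((A_\ell)_{\ell=0}^{k-1},(b_\ell)_{\ell=0}^{k-1},\varphi)$, where each $A_\ell$ is an algorithm with no measurement on $m_\ell$ qubits, $b_0\in\mathbb{Z}[0,2^{m_0})$, $b_\ell:\prod_{i<\ell}\mathbb{Z}[0,2^{m_i})\to\mathbb{Z}[0,2^{m_\ell})$ for $1\le\ell\le k-1$, and $\varphi:\prod_{\ell<k}\mathbb{Z}[0,2^{m_\ell})\to G$. Its output on $f$ is the probability measure $A(f)$ on $G$ which is the distribution of $\varphi(x_0,\dots,x_{k-1})$, where $(x_0,\dots,x_{k-1})$ has probability $\prod_{\ell=0}^{k-1}|A_{\ell,f}(x_\ell,b_\ell(x_0,\dots,x_{\ell-1}))|^2$ (with $b_0$ a constant). Its number of queries is $n_q(A)=\sum_\ell n_q(A_\ell)$. For a random variable $\zeta$ with distribution $A(f)$, let $e(S,A,f)=\inf\{\varepsilon:\ \mathbf{P}\{\|S(f)-\zeta\|>\varepsilon\}\le 1/4\}$, $e(S,A,F)=\sup_{f\in F}e(S,A,f)$, and the $n$-th minimal query error is $e_n^q(S,F)=\inf\{e(S,A,F): A \text{ a quantum algorithm from } F \text{ to } G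 \text{ with } n_q(A)\le n\}$. Summation setting. For $N\in\mathbb{N}$, $D=\mathbb{Z}[0,N)$, $K=G=\mathbb{R}$. For $1\le p<\infty$, $L_p^N$ is the space of functions $f:\mathbb{Z}[0,N)\to\mathbb{R}$ with norm $\|f\|_{L_p^N}=\big(\frac1N\sum_{i=0}^{N-1}|f(i)|^p\big)^{1/p}$; $\mathcal{B}_p^N=\{f\in L_p^N:\|f\|_{L_p^N}\le 1\}$; and $S_N f=\frac1N\sum_{i=0}^{N-1}f(i)$. *)

(* Defs.v *)
From HB Require Import structures.
From mathcomp Require Import all_boot all_order all_algebra.
From mathcomp Require Import all_classical all_reals.
From mathcomp Require Import ereal exp.
From mathcomp Require Import complex.

Unset Printing Implicit Defensive.

Import Order.TTheory GRing.Theory Num.Theory.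
Local Open Scope classical_set_scope.
Local Open Scope ring_scope.

(* Basis states |i> of H_m are indexed by i in Z[0,2^m) (binary        *)
(* expansion, first tensor factor = most significant bits), so         *)
(* |i>|x>|y> in H_m' (x) H_m'' (x) H_(m-m'-m'') is the basis vector    *)
(* with index i*2^(m-m') + x*2^(m-m'-m'') + y.                         *)

Section Quantum.
Variables (R : realType) (D K : Type).
Local Notation C := (R[i]).

(* A quantum query Q = (m, m', m'', Z, tau, beta).  tau is given as a
   function on all of Z[0,2^m'); only its values on Z are ever used
   (D is nonempty, so this is the same as a map Z -> D). *)
Record query := Query {
  q_m : nat;
  q_m1 : nat;
  q_m2 : nat;
  q_m1_pos : (0 < q_m1)%N;
  q_m2_pos : (0 < q_m2)%N;
  q_le : (q_m1 + q_m2 <= q_m)%N;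
  q_Z : {set 'I_(2 ^ q_m1)};
  q_Z_ne : (0 < #|q_Z|)%N;
  q_tau : 'I_(2 ^ q_m1) -> D;
  q_beta : K -> 'I_(2 ^ q_m2) }.

Definition qmap (Q : query) (f : D -> K) (k : 'I_(2 ^ q_m Q)) : 'I_(2 ^ q_m Q) :=
  let r := (q_m Q - q_m1 Q - q_m2 Q)%N in
  let i := (k %/ 2 ^ (q_m Q - q_m1 Q))%N in
  let x := ((k %/ 2 ^ r) %% 2 ^ q_m2 Q)%N in
  let y := (k %% 2 ^ r)%N in
  match (insub i : option 'I_(2 ^ q_m1 Q)) with
  | Some j =>
      if j \in q_Z Q then
        insubd k (i * 2 ^ (q_m Q - q_m1 Q)
                  + ((x + q_beta Q (f (q_tau Q j))) %% 2 ^ q_m2 Q) * 2 ^ r + y)%N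
      else k
  | None => k
  end.

Definition query_mx (Q : query) (f : D -> K) : 'M[C]_(2 ^ q_m Q) :=
  \matrix_(a, b) ((a == qmap Q f b)%:R).

Definition unitary n (U : 'M[C]_n) : Prop := U *m (map_mx conjc U)^T = 1%:M.
Arguments unitary {n} U.

Record alg0 := Alg0 {
  a_q : query;
  a_n : nat;
  a_U : nat -> 'M[C]_(2 ^ q_m a_q);
  a_U_unitary : forall j, (j <= a_n)%N -> unitary (a_U j) }.

Definition alg0_qubits (A : alg0) : nat := q_m (a_q A).

Fixpoint alg0_prod (A : alg0) (f : D -> K) (j : nat) : 'M[C]_(2 ^ q_m (a_q A)) :=
  match j with
  | 0 => a_U A 0
  | j'.+1 => a_U A j'.+1 *m query_mx (a_q A) f *m alg0_prod A f j'
  end.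

Definition alg0_mx (A : alg0) (f : D -> K) := alg0_prod A f (a_n A).

(* matrix entry at natural-number indices (only used in range) *)
Definition entry n (M : 'M[C]_n) (x y : nat) : C :=
  match (insub x : option 'I_n), (insub y : option 'I_n) with
  | Some i, Some j => M i j
  | _, _ => 0
  end.
Arguments entry {n} M x y.

Definition sqnorm (z : C) : R := complex.Re z ^+ 2 + complex.Im z ^+ 2.

(* quantum algorithm from F to G = R with k measurements:
   ((A_l)_{l<k}, (b_l)_{l<k}, phi).  Outcomes x_l in Z[0,2^{m_l}) are
   coded as natural numbers; al_b l applied to the list (x_0,...,x_{l-1})
   is b_l(x_0,...,x_{l-1}) (for l = 0 it is the constant b_0). *)
Record alg := Alg {
  al_k : nat;
  al_k_pos : (0 < al_k)%N;
  al_A : nat -> alg0;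
  al_b : nat -> seq nat -> nat;
  al_b_range : forall l s, (l < al_k)%N -> (al_b l s < 2 ^ alg0_qubits (al_A l))%N;
  al_phi : seq nat -> R }.

Fixpoint tuples (ms : seq nat) : seq (seq nat) :=
  if ms is m :: ms' then [seq x :: t | x <- iota 0 (2 ^ m), t <- tuples ms']
  else [:: [::]].

Definition outcomes (A : alg) : seq (seq nat) :=
  tuples [seq alg0_qubits (al_A A l) | l <- iota 0 (al_k A)].

Definition prob (A : alg) (f : D -> K) (x : seq nat) : R :=
  \prod_(l < al_k A)
     sqnorm (entry (alg0_mx (al_A A l) f) (nth 0%N x l) (al_b A l (take l x))).

Definition nq (A : alg) : nat := (\sum_(l < al_k A) a_n (al_A A l))%N.

Definition fail_prob (S : (D -> K) -> R) (A : alg) (f : D -> K) (eps : R) : R :=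
  \sum_(x <- outcomes A | eps < `|S f - al_phi A x|) prob A f x.

Definition err_f (S : (D -> K) -> R) (A : alg) (f : D -> K) : \bar R :=
  ereal_inf [set eps%:E | eps in [set eps : R | fail_prob S A f eps <= 1 / 4]].

Definition err (S : (D -> K) -> R) (F : set (D -> K)) (A : alg) : \bar R :=
  ereal_sup [set err_f S A f | f in F].

Definition min_query_err (S : (D -> K) -> R) (F : set (D -> K)) (n : nat) : \bar R :=
  ereal_inf [set err S F A | A in [set A : alg | (nq A <= n)%N]].

End Quantum.

Section Summation.
Variable R : realType.

Definition SN (N : nat) (f : 'I_N -> R) : R := N%:R^-1 * \sum_(i < N) f i.

Definition LpN_norm (N : nat) (p : R) (f : 'I_N -> R) : R :=
  (N%:R^-1 * \sum_(i < N) `|f i| `^ p) `^ p^-1.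

Definition BpN (N : nat) (p : R) : set ('I_N -> R) :=
  [set f | LpN_norm N p f <= 1].

Definition log2 (x : R) : R := ln x / ln 2.

End Summation.

(* Main.v *)
(** Lower bound: by the adversary method, a low-error algorithm must tell the
    indicator functions of k-sets from those of (k+1)-sets, suitably scaled.
    Each query moves the sum of the inner products of the final states over all
    pairs (X, X + d) by little, since X and X + d only differ at d, so at least
    of order sqrt ((N - k) (k + 1)) queries are needed; take k of order n^2 / N.

    Upper bound: let T be the scale at which at most kappa ~ n^2 / N values of
    f can exceed T, expand |f| / T in binary, and for every binary digit count
    the positive and negative values having that digit 1. The digits above T
    are sparse, and their counts come out exact with good probability; the
    others only need approximate counts. Query budgets decaying geometrically
    away from T keep the total below n and the error of order T / N.

    One count is a variant of amplitude estimation with an explicit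
    mean-square error. A counter y controls y steps w_0, w_1, ... of the Grover
    walk, which satisfies w_(s-1) + w_(s+1) = 2 c w_s with c = 1 - 2 count / N.
    For a quadratic window a the state sum_s a_s |s> w_s is then almost an
    eigenvector, with eigenvalue c, of half the adjacency matrix J of the path of
    counter values, and measuring J estimates c with mean-square error the
    squared norm of (J - c) applied to the state. *)
Require Import Defs.
From HB Require Import structures.
From mathcomp Require Import all_boot all_order all_algebra.
From mathcomp Require Import all_classical all_reals.
From mathcomp Require Import ereal exp.
From mathcomp Require Import complex.
From mathcomp Require Import spectral.
From mathcomp Require Import zify ring lra.

Import Order.TTheory GRing.Theory Num.Theory.
Local Open Scope classical_set_scope.
Local Open Scope ring_scope.

Set Implicit Arguments.
Unset Strict Implicit.
Arguments q_m {D K}. Arguments q_m1 {D K}. Arguments q_m2 {D K}.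
Arguments q_Z {D K}. Arguments q_tau {D K}. Arguments q_beta {D K}.
Arguments qmap {D K}. Arguments query_mx {R D K}. Arguments unitary {R n}.
Arguments a_q {R D K}. Arguments a_n {R D K}. Arguments a_U {R D K}.
Arguments alg0_qubits {R D K}. Arguments alg0_prod {R D K}.
Arguments alg0_mx {R D K}. Arguments entry {R n}. Arguments sqnorm {R}.
Arguments al_k {R D K}. Arguments al_A {R D K}. Arguments al_b {R D K}.
Arguments al_phi {R D K}. Arguments outcomes {R D K}. Arguments prob {R D K}.
Arguments nq {R D K}. Arguments fail_prob {R D K}. Arguments err_f {R D K}.
Arguments err {R D K}.

(** * Real inner products and the query map *)

Section RealInnerProduct.
Variable R : realType.
Local Notation C := (R[i]).

(** The real part of the conjugate of [z] times [w]; real parts of inner products are enough for the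
    adversary argument and can be compared. *)
Definition rip (z w : C) : R :=
  complex.Re z * complex.Re w + complex.Im z * complex.Im w.

Definition vrip n (phi psi : 'cV[C]_n) : R := \sum_i rip (phi i 0) (psi i 0).

Lemma sqnormE (z : C) : sqnorm z = rip z z.
Proof. by rewrite /sqnorm /rip !expr2. Qed.

Lemma sqnorm_ge0 (z : C) : 0 <= sqnorm z.
Proof. by rewrite /sqnorm addr_ge0 ?sqr_ge0. Qed.

Lemma ripMM (s z w : C) : rip (s * z) (s * w) = sqnorm s * rip z w.
Proof. by case: s => a b; case: z => c d; case: w => e f; rewrite /rip /sqnorm /=; ring. Qed.

Lemma sqnormM (s z : C) : sqnorm (s * z) = sqnorm s * sqnorm z.
Proof. by rewrite !sqnormE ripMM sqnormE. Qed.

(** A weighted arithmetic-geometric mean inequality; the free weight [a] later balances the number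
    of k-sets against that of (k+1)-sets. *)
Lemma ler_rip (a : R) (z w : C) : 0 < a ->
  `|rip z w| <= 2^-1 * (a * sqnorm z + a^-1 * sqnorm w).
Proof.
move=> a0; case: z => c d; case: w => e f; rewrite /rip /sqnorm /=.
have b0 : a^-1 > 0 by rewrite invr_gt0.
have ab : a * a^-1 = 1 by rewrite mulfV ?gt_eqF.
move: (a^-1) b0 ab => b b0 ab.
have H (x y : R) : 2 * `|x * y| <= a * x ^+ 2 + b * y ^+ 2.
  have := mulr_ge0 (ltW a0) (sqr_ge0 (`|x| - b * `|y|)).
  have -> : a * (`|x| - b * `|y|) ^+ 2 =
    a * `|x| ^+ 2 + (a * b) * b * `|y| ^+ 2 - 2 * (a * b) * (`|x| * `|y|) by ring.
  by rewrite ab mul1r mulr1 !real_normK ?num_real// -normrM subr_ge0.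
have := ler_normD (c * e) (d * f); have := H c e; have := H d f; lra.
Qed.

Lemma vripE n (phi psi : 'cV[C]_n) :
  vrip phi psi = complex.Re (((map_mx conjc phi)^T *m psi) 0 0).
Proof.
rewrite mxE raddf_sum; apply: eq_bigr => i _; rewrite !mxE /rip.
by case: (phi i 0) => a b; case: (psi i 0) => c d /=; ring.
Qed.

Lemma unitaryC n (U : 'M[C]_n) : unitary U -> (map_mx conjc U)^T *m U = 1%:M.
Proof. exact: mulmx1C. Qed.

Lemma vrip_unitary n (U : 'M[C]_n) (phi psi : 'cV[C]_n) : unitary U ->
  vrip (U *m phi) (U *m psi) = vrip phi psi.
Proof.
move=> uU; rewrite !vripE map_mxM trmx_mul mulmxA -(mulmxA _ _ U) unitaryC//.
by rewrite mulmx1.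
Qed.

Lemma unitaryM n (U V : 'M[C]_n) : unitary U -> unitary V -> unitary (U *m V).
Proof.
rewrite /unitary => uU uV.
by rewrite map_mxM trmx_mul mulmxA -(mulmxA U) uV mulmx1.
Qed.

Lemma vrip_delta n (b : 'I_n) (s t : C) :
  vrip (s *: delta_mx b 0) (t *: delta_mx b 0) = rip s t.
Proof.
rewrite /vrip (bigD1 b)//= big1 ?addr0 ?mxE ?eqxx ?mulr1// => i ib.
by rewrite !mxE (negbTE ib) !mulr0 /rip /= !mul0r addr0.
Qed.

End RealInnerProduct.

Lemma digits_inj (A B i i' x x' y y' : nat) :
  (0 < B)%N -> (x < A)%N -> (x' < A)%N -> (y < B)%N -> (y' < B)%N ->
  (i * (A * B) + x * B + y = i' * (A * B) + x' * B + y')%N ->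
  [/\ i = i', x = x' & y = y'].
Proof.
move=> B0 xA x'A yB y'B.
rewrite !mulnA -!mulnDl => E.
have Ey : y = y' by move: (congr1 (modn^~ B) E); rewrite !modnMDl !modn_small.
have Ex : (i * A + x = i' * A + x')%N.
  by move: (congr1 (divn^~ B) E); rewrite !divnMDl// !divn_small// !addn0.
have Exx : x = x' by move: (congr1 (modn^~ A) Ex); rewrite !modnMDl !modn_small.
split=> //; have A0 : (0 < A)%N by case: A xA {x'A E Ex}.
by move: (congr1 (divn^~ A) Ex); rewrite !divnMDl// !divn_small// !addn0.
Qed.

Lemma digits_lt (A B M i x y : nat) :
  (i < M)%N -> (x < A)%N -> (y < B)%N -> (i * (A * B) + x * B + y < M * (A * B))%N.
Proof.
move=> iM xA yB; rewrite mulnA mulnA -mulnDl.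
apply: (@leq_trans ((i * A + x).+1 * B)); first by rewrite mulSn addnC ltn_add2r.
rewrite leq_mul2r; apply/orP; right.
by apply: (@leq_trans (i.+1 * A)); [rewrite mulSn addnC ltn_add2r | rewrite leq_mul2r iM orbT].
Qed.

Lemma digitsE (A B k : nat) : (0 < A)%N -> (0 < B)%N ->
  (k %/ (A * B) * (A * B) + (k %/ B %% A) * B + k %% B)%N = k.
Proof.
move=> A0 B0; have -> : (k %/ (A * B) = k %/ B %/ A)%N by rewrite mulnC divnMA.
by rewrite mulnA -mulnDl -divn_eq -divn_eq.
Qed.

Section QueryMap.
Variables (D K : Type) (Q : query D K).
Let r := (q_m Q - q_m1 Q - q_m2 Q)%N.

Definition qindex (k : nat) : nat := (k %/ (2 ^ q_m2 Q * 2 ^ r))%N.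
Definition qvalue (k : nat) : nat := (k %/ 2 ^ r %% 2 ^ q_m2 Q)%N.
Definition qrest (k : nat) : nat := (k %% 2 ^ r)%N.

Lemma q_m_split : (2 ^ q_m Q = 2 ^ q_m1 Q * (2 ^ q_m2 Q * 2 ^ r))%N.
Proof. by rewrite -!expnD; congr (_ ^ _)%N; have := @q_le _ _ Q; rewrite /r; lia. Qed.

Lemma q_block : (2 ^ (q_m Q - q_m1 Q) = 2 ^ q_m2 Q * 2 ^ r)%N.
Proof. by rewrite -expnD; congr (_ ^ _)%N; have := @q_le _ _ Q; rewrite /r; lia. Qed.

Lemma qindex_lt (k : 'I_(2 ^ q_m Q)) : (qindex k < 2 ^ q_m1 Q)%N.
Proof.
by rewrite /qindex ltn_divLR ?muln_gt0 ?expn_gt0// -q_m_split ltn_ord.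
Qed.

Definition qord (k : 'I_(2 ^ q_m Q)) : 'I_(2 ^ q_m1 Q) := Ordinal (qindex_lt k).

Lemma qmapE (f : D -> K) k :
  (qmap Q f k = (if qord k \in q_Z Q then
     qindex k * (2 ^ q_m2 Q * 2 ^ r)
     + ((qvalue k + q_beta Q (f (q_tau Q (qord k)))) %% 2 ^ q_m2 Q) * 2 ^ r
     + qrest k else k) :> nat)%N.
Proof.
rewrite /qmap -/r q_block; case: insubP => [j _ Ej|]; last first.
  by rewrite -leqNgt leqNgt (qindex_lt k).
have -> : j = qord k by apply: val_inj; rewrite /= Ej.
case: ifP => // _; rewrite val_insubd; case: ifP => // /negP[].
by rewrite [ltnRHS]q_m_split digits_lt ?ltn_mod ?expn_gt0 ?qindex_lt.
Qed.

Lemma qindex_digits i x y : (x < 2 ^ q_m2 Q)%N -> (y < 2 ^ r)%N ->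
  [/\ qindex (i * (2 ^ q_m2 Q * 2 ^ r) + x * 2 ^ r + y)%N = i,
      qvalue (i * (2 ^ q_m2 Q * 2 ^ r) + x * 2 ^ r + y)%N = x &
      qrest (i * (2 ^ q_m2 Q * 2 ^ r) + x * 2 ^ r + y)%N = y].
Proof.
move=> xl yl; have p2 : (0 < 2 ^ q_m2 Q)%N by rewrite expn_gt0.
have pr : (0 < 2 ^ r)%N by rewrite expn_gt0.
by apply: (@digits_inj (2 ^ q_m2 Q) (2 ^ r)) => //; rewrite /qindex /qvalue /qrest ?ltn_mod ?digitsE.
Qed.

Lemma qdigitsE k :
  (qindex k * (2 ^ q_m2 Q * 2 ^ r) + qvalue k * 2 ^ r + qrest k = k)%N.
Proof. by apply: digitsE; rewrite expn_gt0. Qed.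

Lemma qindex_qmap (f : D -> K) k : qord (qmap Q f k) = qord k.
Proof.
apply: val_inj => /=; rewrite qmapE; case: ifP => // _.
by case: (@qindex_digits (qindex k)
  ((qvalue k + q_beta Q (f (q_tau Q (qord k)))) %% 2 ^ q_m2 Q) (qrest k));
  rewrite ?ltn_mod ?expn_gt0.
Qed.

(** The address register is left alone, so two basis states with equal images were shifted by the
    same amount. A query thus permutes the basis, and sums over basis states can be reindexed along
    it. *)
Lemma qmap_inj (f : D -> K) : injective (qmap Q f).
Proof.
move=> k k' E; have Eo : qord k = qord k' by rewrite -(qindex_qmap f) E qindex_qmap.
have := congr1 val E; rewrite /= !qmapE Eo; case: ifP => [_|_]; last exact: val_inj.
case/digits_inj; rewrite ?ltn_mod ?expn_gt0// => Ei /eqP Ex Ey.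
apply: val_inj; rewrite /= -(qdigitsE k) -(qdigitsE k') Ei Ey; congr (_ + _ * _ + _)%N.
move: Ex; rewrite eqn_modDr => /eqP.
by rewrite !modn_small// /qvalue ltn_mod expn_gt0.
Qed.

Lemma eq_qmap (f g : D -> K) k :
  f (q_tau Q (qord k)) = g (q_tau Q (qord k)) -> qmap Q f k = qmap Q g k.
Proof. by move=> E; apply: val_inj; rewrite /= !qmapE E. Qed.

Lemma query_mxE (R : realType) (f : D -> K) (phi : 'cV[R[i]]_(2 ^ q_m Q)) k :
  (query_mx Q f *m phi) (qmap Q f k) 0 = phi k 0.
Proof.
rewrite mxE (bigD1 k)//= mxE eqxx mul1r big1 ?addr0// => j jk.
by rewrite mxE (inj_eq (@qmap_inj f)) eq_sym (negbTE jk) mul0r.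
Qed.

End QueryMap.

(** * Query weights and the hybrid argument *)

Section QueryWeight.
Variables (R : realType) (D : finType) (K : Type).
Local Notation C := (R[i]).

Definition queries_at (Q : query D K) (d : D) (k : 'I_(2 ^ q_m Q)) : bool :=
  (qord k \in q_Z Q) && (q_tau Q (qord k) == d).

(** The query magnitude of [d]: the probability that a query made in the unit state [phi] reads the
    point [d]. *)
Definition mass_at (Q : query D K) (d : D) (phi : 'cV[C]_(2 ^ q_m Q)) : R :=
  \sum_(k | queries_at d k) sqnorm (phi k 0).

Lemma reindex_query (Q : query D K) (f : D -> K) (P : pred 'I_(2 ^ q_m Q))
    (F : 'I_(2 ^ q_m Q) -> R) :
  (forall k, P (qmap Q f k) = P k) ->
  \sum_(k | P k) F k = \sum_(k | P k) F (qmap Q f k).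
Proof.
move=> PE; rewrite (reindex_inj (@qmap_inj _ _ Q f)).
by apply: eq_bigl => k; rewrite PE.
Qed.

Lemma queries_at_qmap (Q : query D K) f d k :
  queries_at d (qmap Q f k) = queries_at d k.
Proof. by rewrite /queries_at qindex_qmap. Qed.

Lemma mass_at_query (Q : query D K) f d phi :
  mass_at d (query_mx Q f *m phi) = mass_at d phi.
Proof.
rewrite /mass_at (reindex_query (f := f)) => [|k]; last exact: queries_at_qmap.
by apply: eq_bigr => k _; rewrite query_mxE.
Qed.

Lemma vrip_query (Q : query D K) f (phi psi : 'cV[C]_(2 ^ q_m Q)) :
  vrip (query_mx Q f *m phi) (query_mx Q f *m psi) = vrip phi psi.
Proof.
rewrite /vrip (reindex_query (f := f))//.
by apply: eq_bigr => k _; rewrite !query_mxE.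
Qed.

(** Basis states that do not read [d] are permuted alike by both queries, so their share of the
    inner product is unchanged. The share of the others is bounded by [ler_rip] before and after the
    query, and the two factors 1/2 add up to 1. *)
Lemma vrip_query_diff (Q : query D K) f g d (a : R)
    (phi psi : 'cV[C]_(2 ^ q_m Q)) :
  0 < a -> (forall e, e != d -> f e = g e) ->
  `|vrip (query_mx Q f *m phi) (query_mx Q g *m psi) - vrip phi psi|
    <= a * mass_at d phi + a^-1 * mass_at d psi.
Proof.
move=> a0 fg; set phi' := query_mx Q f *m phi; set psi' := query_mx Q g *m psi.
have off : \sum_(k | ~~ queries_at d k) rip (phi' k 0) (psi' k 0) =
           \sum_(k | ~~ queries_at d k) rip (phi k 0) (psi k 0).
  rewrite (reindex_query (f := f)) => [|k]; last by rewrite queries_at_qmap.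
  apply: eq_bigr => k; rewrite negb_and query_mxE => kd.
  suff -> : qmap Q f k = qmap Q g k by rewrite query_mxE.
  case/orP: kd => kd; last by apply: eq_qmap; apply: fg.
  by apply: val_inj; rewrite /= !qmapE (negbTE kd).
have on (u v : 'cV[C]_(2 ^ q_m Q)) :
    `|\sum_(k | queries_at d k) rip (u k 0) (v k 0)|
    <= 2^-1 * (a * mass_at d u + a^-1 * mass_at d v).
  apply: (le_trans (ler_norm_sum _ _ _)).
  rewrite /mass_at !mulr_sumr -big_split mulr_sumr.
  by apply: ler_sum => k _; apply: ler_rip.
have split (u v : 'cV[C]_(2 ^ q_m Q)) : vrip u v =
    \sum_(k | queries_at d k) rip (u k 0) (v k 0) +
    \sum_(k | ~~ queries_at d k) rip (u k 0) (v k 0).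
  by rewrite /vrip (bigID (queries_at d)).
rewrite !split off opprD addrACA subrr addr0; apply: (le_trans (ler_normB _ _)).
have := on phi' psi'; have := on phi psi; rewrite !mass_at_query; lra.
Qed.

Variable A : alg0 R D K.

Definition run (f : D -> K) (b : 'I_(2 ^ q_m (a_q A))) (j : nat) :=
  alg0_prod A f j *m (delta_mx b 0 : 'cV[C]__).

Definition qweight (f : D -> K) b (n : nat) (d : D) : R :=
  \sum_(j < n) mass_at d (run f b j).

Lemma runS f b j :
  run f b j.+1 = a_U A j.+1 *m (query_mx (a_q A) f *m run f b j).
Proof. by rewrite /run /= !mulmxA. Qed.

Lemma vrip_run f b j : (j <= a_n A)%N -> vrip (run f b j) (run f b j) = 1.
Proof.
elim: j => [|j IH] jn.
  rewrite /run /= vrip_unitary; last exact: a_U_unitary.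
  by rewrite -[delta_mx b 0]scale1r vrip_delta /rip /= mulr1 mulr0 addr0.
rewrite runS vrip_unitary; last exact: a_U_unitary.
by rewrite vrip_query IH // ltnW.
Qed.

Lemma sum_qweight f b n : (n <= (a_n A).+1)%N -> \sum_d qweight f b n d <= n%:R.
Proof.
move=> nA; rewrite exchange_big /= -[n in n%:R]card_ord -sum1_card natr_sum.
apply: ler_sum => j _; have jA : (j <= a_n A)%N by rewrite -ltnS (leq_trans (ltn_ord j)).
rewrite -(vrip_run f b jA) /mass_at (exchange_big_dep xpredT)//=.
apply: ler_sum => k _; rewrite -sqnormE /queries_at.
case: (qord k \in _) => /=; last by rewrite big_pred0// sqnorm_ge0.
by rewrite (eq_bigl (pred1 (q_tau (a_q A) (qord k)))) ?big_pred1_eq// => d; rewrite /= eq_sym.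
Qed.

Lemma vripZ n (s t : C) (phi psi : 'cV[C]_n) :
  vrip (s *: phi) (t *: psi) = \sum_i rip (s * phi i 0) (t * psi i 0).
Proof. by apply: eq_bigr => i _; rewrite !mxE. Qed.

Lemma mass_atZ (s : C) d phi :
  mass_at d (s *: phi) = sqnorm s * mass_at (Q := a_q A) d phi.
Proof. by rewrite /mass_at mulr_sumr; apply: eq_bigr => k _; rewrite mxE sqnormM. Qed.

(** The unitaries preserve inner products, so only the queries contribute. The scalars [s] and [t]
    stand for the amplitudes of the outcomes measured before this stage. *)
Lemma vrip_run_diff f g d (a : R) (s t : C) b j :
  0 < a -> (forall e, e != d -> f e = g e) -> (j <= a_n A)%N ->
  `|vrip (s *: run f b j) (t *: run g b j) - rip s t|
    <= a * (sqnorm s * qweight f b j d) + a^-1 * (sqnorm t * qweight g b j d).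
Proof.
move=> a0 fg; elim: j => [|j IH] jA.
  rewrite /run /= !scalemxAr vrip_unitary; last exact: a_U_unitary.
  by rewrite vrip_delta subrr normr0 /qweight !big_ord0 !mulr0 addr0.
rewrite !runS.
rewrite 2!(scalemxAr s) 2!(scalemxAr t) vrip_unitary; last exact: a_U_unitary.
rewrite /qweight !big_ord_recr /= -/(qweight _ _ _ _) -/(qweight _ _ _ _).
have := IH (ltnW jA).
have := vrip_query_diff (s *: run f b j) (t *: run g b j) a0 fg.
rewrite !mass_atZ !mulrDr.
set x := vrip _ _; set y := vrip _ _; move=> H1 H2.
have -> : x - rip s t = (x - y) + (y - rip s t) by ring.
by apply: (le_trans (ler_normD _ _)); lra.
Qed.

End QueryWeight.

(** * Adversary lower bound *)

Lemma tuples_cons m ms :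
  tuples (m :: ms) = [seq x :: t | x <- iota 0 (2 ^ m), t <- tuples ms].
Proof. by []. Qed.

(** [tuples] grows at the head whereas measurements append outcomes at the tail; this is the
    recursion on the last stage. *)
Lemma big_tuples_rcons (V : nmodType) ms m (F : seq nat -> V) :
  \sum_(x <- tuples (rcons ms m)) F x =
  \sum_(x <- tuples ms) \sum_(y < 2 ^ m) F (rcons x y).
Proof.
elim: ms F => [|a ms IH] F.
  rewrite [rcons _ _]/= tuples_cons big_allpairs_dep big_seq1 /=.
  rewrite -(big_mkord xpredT (fun y => F [:: y])).
  by rewrite /index_iota subn0; apply: eq_bigr => y _; rewrite big_seq1.
rewrite rcons_cons !tuples_cons !big_allpairs_dep; apply: eq_bigr => x _.
by rewrite (IH (fun t => F (x :: t))).
Qed.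

Lemma size_tuples ms x : x \in tuples ms -> size x = size ms.
Proof.
elim: ms x => [|m ms IH] x; first by rewrite inE => /eqP->.
by rewrite tuples_cons => /allpairsP[[y t] /= [_ /IH tms ->]]; rewrite /= tms.
Qed.

Lemma iotaSr m n : iota m n.+1 = rcons (iota m n) (m + n)%N.
Proof. by rewrite -addn1 iotaD /= cats1. Qed.

Lemma entryE (R : realType) n (M : 'M[R[i]]_n) (i j : 'I_n) : entry M i j = M i j.
Proof. by rewrite /entry !valK. Qed.

Section Adversary.
Variables (R : realType) (D : finType) (K : Type) (A : alg R D K).
Local Notation C := (R[i]).

(** Keeping the complex amplitude of an outcome sequence, not only its probability, carries the
    inner product of two runs across measurements. *)
Definition amplitude (f : D -> K) l (x : seq nat) : C :=
  \prod_(i < l) entry (alg0_mx (al_A A i) f) (nth 0%N x i) (al_b A i (take i x)).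

Definition prefixes l : seq (seq nat) :=
  tuples [seq alg0_qubits (al_A A i) | i <- iota 0 l].

Lemma probE f x : prob A f x = sqnorm (amplitude f (al_k A) x).
Proof.
rewrite /prob /amplitude; apply/esym/big_morph => [z w|]; first exact: sqnormM.
by rewrite /sqnorm /= expr1n expr0n addr0.
Qed.

Lemma big_prefixesS (V : nmodType) l (F : seq nat -> V) :
  \sum_(x <- prefixes l.+1) F x =
  \sum_(x <- prefixes l) \sum_(y < 2 ^ alg0_qubits (al_A A l)) F (rcons x y).
Proof. by rewrite /prefixes iotaSr map_rcons big_tuples_rcons. Qed.

Lemma size_prefixes l x : x \in prefixes l -> size x = l.
Proof. by move=> /size_tuples; rewrite size_map size_iota. Qed.

Lemma amplitude_rcons f l x y : size x = l ->
  amplitude f l.+1 (rcons x y) =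
  amplitude f l x * entry (alg0_mx (al_A A l) f) y (al_b A l x).
Proof.
move=> xl; rewrite /amplitude big_ord_recr /=; congr (_ * _).
  apply: eq_bigr => i _; rewrite nth_rcons xl ltn_ord -cats1 takel_cat//.
  by rewrite xl ltnW.
by rewrite nth_rcons xl ltnn eqxx -xl -cats1 take_size_cat.
Qed.

Definition start l (lk : (l < al_k A)%N) (x : seq nat) :=
  Ordinal (@al_b_range _ _ _ A l x lk).

Definition run_weight f l x (lk : (l < al_k A)%N) d : R :=
  sqnorm (amplitude f l x) *
  qweight (A := al_A A l) f (start lk x) (a_n (al_A A l)) d.

(** The outcomes of stage [l] index the coordinates of its final state, so summing over them
    restores the inner products of the unmeasured states. *)
Lemma sum_rip_step f g l (lk : (l < al_k A)%N) :
  \sum_(x <- prefixes l.+1) rip (amplitude f l.+1 x) (amplitude g l.+1 x) =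
  \sum_(x <- prefixes l)
    vrip (amplitude f l x *: run f (start lk x) (a_n (al_A A l)))
         (amplitude g l x *: run g (start lk x) (a_n (al_A A l))).
Proof.
rewrite big_prefixesS; apply: eq_big_seq => x /size_prefixes xl.
rewrite vripZ; apply: eq_bigr => y _; rewrite !amplitude_rcons//.
rewrite -[al_b A l x]/(nat_of_ord (start lk x)) !entryE /run /alg0_mx.
by rewrite -!colE !mxE.
Qed.

Lemma sum_prob_prefix f l : (l <= al_k A)%N ->
  \sum_(x <- prefixes l) sqnorm (amplitude f l x) = 1.
Proof.
elim: l => [_|l IH lk].
  by rewrite big_seq1 /amplitude big_ord0 /sqnorm /= expr1n expr0n addr0.
rewrite -[RHS](IH (ltnW lk)) (eq_bigr _ (fun x _ => sqnormE _)) (sum_rip_step _ _ lk).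
apply: eq_bigr => x _; rewrite vripZ (eq_bigr _ (fun y _ => ripMM _ _ _)) -mulr_sumr.
by rewrite [X in _ * X](@vrip_run _ _ _ (al_A A l)) ?mulr1.
Qed.

Lemma sum_prob f : \sum_(x <- outcomes A) prob A f x = 1.
Proof. by rewrite (eq_bigr _ (fun x _ => probE f x)) sum_prob_prefix. Qed.

Definition total_weight f d : R :=
  \sum_(l < al_k A) \sum_(x <- prefixes l) run_weight f x (ltn_ord l) d.

(** One query has total mass at most 1 over all points, and the prefix probabilities of each stage
    add up to 1. *)
Lemma sum_total_weight f : \sum_d total_weight f d <= (nq A)%:R.
Proof.
rewrite exchange_big /nq natr_sum /=; apply: ler_sum => l _.
rewrite exchange_big /= -[leRHS]mul1r.
rewrite -[X in _ <= X * _](sum_prob_prefix f (ltnW (ltn_ord l))) mulr_suml.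
apply: ler_sum => x _; rewrite -mulr_sumr ler_wpM2l ?sqnorm_ge0//.
exact: (@sum_qweight _ _ _ (al_A A l)).
Qed.

Lemma sum_rip_diff f g d (a : R) : 0 < a -> (forall e, e != d -> f e = g e) ->
  `|\sum_(x <- outcomes A) rip (amplitude f (al_k A) x) (amplitude g (al_k A) x) - 1|
    <= a * total_weight f d + a^-1 * total_weight g d.
Proof.
move=> a0 fg; pose S l := \sum_(x <- prefixes l) rip (amplitude f l x) (amplitude g l x).
have -> : \sum_(x <- outcomes A) rip (amplitude f (al_k A) x) (amplitude g (al_k A) x) - 1
    = \sum_(l < al_k A) (S l.+1 - S l).
  rewrite -(big_mkord xpredT (fun l => S l.+1 - S l)) telescope_sumr//; congr (_ - _).
  by rewrite /S big_seq1 /amplitude !big_ord0 /rip /= mulr1 mulr0 addr0.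
apply: (le_trans (ler_norm_sum _ _ _)).
rewrite /total_weight !mulr_sumr -big_split; apply: ler_sum => l _ /=.
rewrite /S (sum_rip_step _ _ (ltn_ord l)) -sumrB.
apply: (le_trans (ler_norm_sum _ _ _)).
rewrite !mulr_sumr -big_split; apply: ler_sum => x _ /=.
exact: vrip_run_diff.
Qed.

Lemma fail_prob_le (S : (D -> K) -> R) f e e' : e <= e' ->
  fail_prob S A f e' <= fail_prob S A f e.
Proof.
move=> ee'; rewrite /fail_prob big_mkcond [leRHS]big_mkcond; apply: ler_sum => x _.
have p0 : 0 <= prob A f x by rewrite probE sqnorm_ge0.
by case: ifPn => [/(le_lt_trans ee') ->//|_]; case: ifP.
Qed.

(* 7/8 > sqrt 3 / 2, the largest fidelity of two states which a measurement
   separates with error probability 1/4. *)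
Lemma fidelity_separated (S : (D -> K) -> R) f g e :
  2 * e < `|S f - S g| ->
  fail_prob S A f e <= 1 / 4 -> fail_prob S A g e <= 1 / 4 ->
  \sum_(x <- outcomes A) rip (amplitude f (al_k A) x) (amplitude g (al_k A) x) <= 7 / 8.
Proof.
move=> Sfg Ff Fg; pose B x := e < `|S f - al_phi A x|.
pose p := \sum_(x <- outcomes A | B x) prob A f x.
pose q := \sum_(x <- outcomes A | ~~ B x) prob A g x.
have pE : p <= 1 / 4 by [].
have qE : q <= 1 / 4.
  apply: le_trans Fg; rewrite /q /fail_prob big_mkcond [leRHS]big_mkcond.
  apply: ler_sum => x _; have p0 : 0 <= prob A g x by rewrite probE sqnorm_ge0.
  case: ifPn => [|_]; last by case: ifP.
  (* An outcome within [e] of both values would put them at most 2e apart, so every outcome outside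
     [B] is a failure for [g]. *)
  rewrite /B -leNgt => Bx; case: ifPn => //; rewrite -leNgt => Bx'.
  have := ler_normD (S f - al_phi A x) (al_phi A x - S g).
  rewrite (_ : S f - _ + _ = S f - S g); last by ring.
  by rewrite -[`|al_phi A x - _|]normrN opprB => H; exfalso; lra.
have p' : \sum_(x <- outcomes A | ~~ B x) prob A f x = 1 - p.
  have := sum_prob f; rewrite (bigID B) /= -/(fail_prob S A f e) => <-.
  by rewrite [RHS]addrAC subrr add0r.
have q' : \sum_(x <- outcomes A | B x) prob A g x = 1 - q.
  by have := sum_prob g; rewrite (bigID B) /= -/q => <-; rewrite addrK.
have H (P : pred (seq nat)) (a : R) : 0 < a ->
    \sum_(x <- outcomes A | P x) rip (amplitude f (al_k A) x) (amplitude g (al_k A) x)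
    <= 2^-1 * (a * \sum_(x <- outcomes A | P x) prob A f x
               + a^-1 * \sum_(x <- outcomes A | P x) prob A g x).
  move=> a0; rewrite !mulr_sumr -big_split mulr_sumr; apply: ler_sum => x _.
  by rewrite !probE; apply: le_trans (ler_norm _) (ler_rip _ _ a0).
rewrite (bigID B) /=.
(* The optimal weight is sqrt 3, the root of the ratio of 3/4 to 1/4; the approximation 7/4 is good
   enough for the bound 7/8. *)
have a0 : 0 < 7 / 4 :> R by lra.
have b0 : 0 < 4 / 7 :> R by lra.
have := H B _ a0; have := H (predC B) _ b0; rewrite /= p' q' -/p -/q => H1 H2.
have i1 : (7 / 4)^-1 = 4 / 7 :> R by rewrite invf_div.
have i2 : (4 / 7)^-1 = 7 / 4 :> R by rewrite invf_div.
move: H1 H2; rewrite i1 i2; lra.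
Qed.

End Adversary.

(** Double counting of the pairs (X, X + d): the left side is indexed by the smaller set, the right
    side by the larger one. *)
Lemma sum_set_add (V : nmodType) (D : finType) k (F : {set D} -> D -> V) :
  \sum_(S : {set D} | #|S| == k) \sum_(d | d \notin S) F S d =
  \sum_(T : {set D} | #|T| == k.+1) \sum_(d in T) F (T :\ d) d.
Proof.
rewrite !pair_big_dep /=.
rewrite (reindex_onto (fun u : {set D} * D => (u.1 :\ u.2, u.2))
                      (fun u : {set D} * D => (u.2 |: u.1, u.2))) /=; last first.
  by case=> S d /= /andP[_ dS]; rewrite finset.setU1K.
apply: eq_bigl => -[T d] /=; rewrite finset.setD11 andbT xpair_eqE eqxx andbT.
have [dT|dT] := boolP (d \in T).
  by rewrite finset.setD1K// eqxx !andbT [in RHS](cardsD1 d T) dT add1n eqSS.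
rewrite andbF; apply/negP => /andP[_ /eqP E].
by move/negP: dT; apply; rewrite -E finset.setU11.
Qed.

Lemma card_ksets (D : finType) j : #|(fun S : {set D} => #|S| == j)| = 'C(#|D|, j).
Proof. by rewrite -card_draws; apply: eq_card => S; rewrite finset.in_set. Qed.

Lemma card_set_add (D : finType) k :
  (#|(fun S : {set D} => #|S| == k)| * (#|D| - k) =
   #|(fun S : {set D} => #|S| == k.+1)| * k.+1)%N.
Proof.
have := sum_set_add k (fun (_ : {set D}) (_ : D) => 1%N).
under eq_bigr => S /eqP Sk.
  rewrite (eq_bigl (mem (~: S))) => [|d]; last by rewrite /= inE.
  by rewrite sum1_card cardsCs finset.setCK Sk over.
under [RHS]eq_bigr => S /eqP Sk do rewrite sum1_card Sk.
by rewrite !sum_nat_const.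
Qed.

Section LowerBound.
Variables (R : realType) (D : finType) (K : Type) (A : alg R D K).

(** The inner product of each pair (X, X + d) drops from 1 to at most 7/8. The loss is charged to
    the query weights of [f X] and [f (d |: X)] at [d], whose sums over [d] are at most [n]. *)
Lemma adversary_bound (S : (D -> K) -> R) (f : {set D} -> D -> K) k n e :
  (k < #|D|)%N -> (0 < n)%N -> (nq A <= n)%N ->
  (forall (X : {set D}) d, d \notin X ->
     forall e', e' != d -> f X e' = f (d |: X) e') ->
  (forall (X : {set D}) d, #|X| = k -> d \notin X ->
     2 * e < `|S (f X) - S (f (d |: X))|) ->
  (forall X : {set D}, (#|X| == k) || (#|X| == k.+1) -> fail_prob S A (f X) e <= 1 / 4) ->
  ((#|D| - k) * k.+1 <= 256 * n ^ 2)%N.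
Proof.
move=> kD n0 An fadd Ssep Afail.
pose X := #|(fun S : {set D} => #|S| == k)|.
pose Y := #|(fun S : {set D} => #|S| == k.+1)|.
have XY : X%:R * (#|D| - k)%:R = Y%:R * k.+1%:R :> R by rewrite -!natrM card_set_add.
have n0R : 0 < n%:R :> R by rewrite ltr0n.
have Dk : 0 < (#|D| - k)%:R :> R by rewrite ltr0n subn_gt0.
have Ypos : 0 < Y%:R :> R.
  rewrite ltr0n -(@ltn_pmul2r k.+1)// mul0n -card_set_add muln_gt0 subn_gt0 kD andbT.
  by rewrite card_ksets bin_gt0 ltnW.
(* With this weight the k-sets account for at most half of the required loss, 1/16 per pair; the
   other half must come from the (k+1)-sets. *)
pose a : R := (#|D| - k)%:R / (16 * n%:R).
have a0 : 0 < a by rewrite divr_gt0 ?mulr_gt0.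
have key : 8^-1 * (X%:R * (#|D| - k)%:R) <= a * (X%:R * n%:R) + a^-1 * (Y%:R * n%:R).
  have -> : 8^-1 * (X%:R * (#|D| - k)%:R) =
    \sum_(T : {set D} | #|T| == k) \sum_(d | d \notin T) 8^-1 :> R.
    rewrite (eq_bigr (fun=> 8^-1 * (#|D| - k)%:R)) => [|T /eqP Tk].
      by rewrite sumr_const -[RHS]mulr_natl -/X mulrCA.
    rewrite (eq_bigl (mem (~: T))) => [|d]; last by rewrite /= inE.
    by rewrite sumr_const cardsCs finset.setCK Tk mulr_natr.
  apply: (@le_trans _ _ (\sum_(T : {set D} | #|T| == k) \sum_(d | d \notin T)
     (a * total_weight A (f T) d + a^-1 * total_weight A (f (d |: T)) d))).
    apply: ler_sum => T /eqP Tk; apply: ler_sum => d dT.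
    have := sum_rip_diff A a0 (@fadd T d dT).
    have := @fidelity_separated _ _ _ A S _ _ e (Ssep T d Tk dT).
    rewrite !Afail; last 2 first.
    - by rewrite cardsU1 dT Tk add1n eqxx orbT.
    - by rewrite Tk eqxx.
    move=> /(_ isT isT) F; rewrite ler_norml => /andP[F2 _].
    by move: F F2; lra.
  under eq_bigr => T _ do rewrite big_split.
  rewrite big_split /= lerD//.
    apply: (@le_trans _ _ (\sum_(T : {set D} | #|T| == k) a * n%:R)); last first.
      by rewrite sumr_const -[leLHS]mulr_natl -/X mulrCA.
    apply: ler_sum => T _; rewrite -mulr_sumr ler_pM2l//.
    apply: (@le_trans _ _ (nq A)%:R); last by rewrite ler_nat.
    apply: le_trans (sum_total_weight A (f T)).
    rewrite big_mkcond /=; apply: ler_sum => d _; case: ifP => // _.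
    by apply: sumr_ge0 => l _; apply: sumr_ge0 => x _; rewrite /run_weight mulr_ge0 ?sqnorm_ge0 //;
      apply: sumr_ge0 => j _; apply: sumr_ge0 => i _; exact: sqnorm_ge0.
  rewrite sum_set_add.
  apply: (@le_trans _ _ (\sum_(T : {set D} | #|T| == k.+1) a^-1 * n%:R)); last first.
    by rewrite sumr_const -[leLHS]mulr_natl -/Y mulrCA.
  apply: ler_sum => T _; rewrite -mulr_sumr ler_pM2l ?invr_gt0//.
  apply: (@le_trans _ _ (nq A)%:R); last by rewrite ler_nat.
  apply: le_trans (sum_total_weight A (f T)).
  rewrite big_mkcond /=; apply: ler_sum => d _; case: ifP => [dT|_]; first by rewrite finset.setD1K.
  by apply: sumr_ge0 => l _; apply: sumr_ge0 => x _; rewrite /run_weight mulr_ge0 ?sqnorm_ge0 //;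
      apply: sumr_ge0 => j _; apply: sumr_ge0 => i _; exact: sqnorm_ge0.
have aE : a * n%:R = (#|D| - k)%:R / 16 by rewrite /a; field; rewrite gt_eqF.
have key2 : (#|D| - k)%:R * (X%:R * (#|D| - k)%:R) <= 256 * n%:R ^+ 2 * Y%:R :> R.
  have {}key : 16^-1 * (X%:R * (#|D| - k)%:R) <= a^-1 * (Y%:R * n%:R).
    by move: key; rewrite (mulrCA a) aE; lra.
  have -> : 256 * n%:R ^+ 2 * Y%:R = 16 * (#|D| - k)%:R * (a^-1 * (Y%:R * n%:R)).
    by rewrite /a invf_div; field; rewrite gt_eqF.
  rewrite [leLHS](_ : _ = 16 * (#|D| - k)%:R * (16^-1 * (X%:R * (#|D| - k)%:R))).
    by rewrite ler_pM2l// mulr_gt0.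
  by field.
rewrite -(ler_nat R) !natrM -expr2 -(ler_pM2r Ypos).
by apply: le_trans key2; rewrite XY mulrA mulrAC.
Qed.

End LowerBound.

(** The rate as a threshold divided by N: with x = N and y of order n, a function of the unit ball
    reaches the threshold (x/y)^(2/p) at no more than about n^2/N points. *)
Lemma powR_scale (R : realType) (p x y : R) : 0 < x -> 0 < y ->
  (x ^+ 2 / y ^+ 2) `^ p^-1 / x = y `^ (- (2 / p)) * x `^ (2 / p - 1).
Proof.
move=> x0 y0; rewrite -expr_div_n -powR_mulrn; last by rewrite divr_ge0 ?ltW.
rewrite -powRrM powRM ?invr_ge0 ?ltW//.
rewrite -[y^-1]powR_inv1 ?ltW// -[(y `^ -1) `^ _]powRrM mulN1r powRB; last first.
  by rewrite (gt_eqF x0) implybT.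
by rewrite powRr1 ?ltW// mulrCA mulrA.
Qed.

(** * Hard instances for the mean *)

Section LowerBoundSum.
Variables (R : realType) (p : R).
Hypothesis p1 : 1 <= p.

Let p0 : 0 < p. Proof. exact: lt_le_trans p1. Qed.

Definition spike N (v : R) (X : {set 'I_N}) (i : 'I_N) : R := if i \in X then v else 0.

Lemma sum_spike N v (X : {set 'I_N}) (g : R -> R) : g 0 = 0 ->
  \sum_i g (spike v X i) = #|X|%:R * g v.
Proof.
move=> g0; rewrite (bigID (mem X)) /= [X in _ + X]big1 => [|i iX]; last first.
  by rewrite /spike (negbTE iX).
rewrite addr0 (eq_bigr (fun=> g v)) => [|i iX]; last by rewrite /spike iX.
by rewrite sumr_const mulr_natl.
Qed.

Lemma spike_ball N k (X : {set 'I_N}) : (0 < N)%N -> (#|X| <= k.+1)%N ->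
  BpN R N p (spike ((N%:R / k.+1%:R) `^ p^-1) X).
Proof.
move=> N0 Xk; rewrite /BpN /= /LpN_norm.
rewrite (sum_spike _ _ (g := fun x => `|x| `^ p)); last by rewrite normr0 powR0// gt_eqF.
rewrite ger0_norm ?powR_ge0// -powRrM mulVf ?gt_eqF// powRr1 ?divr_ge0//.
rewrite [leRHS](_ : _ = 1 `^ p^-1); last by rewrite powR1.
rewrite ge0_ler_powR ?nnegrE ?invr_ge0 ?mulr_ge0 ?divr_ge0 ?(ltW p0)//.
rewrite mulrCA (mulrA N%:R^-1) mulVf ?mul1r ?pnatr_eq0 -?lt0n//.
by rewrite ler_pdivrMr ?mul1r ?ler_nat.
Qed.

Lemma lower_bound (c0 : R) n N : 0 < c0 -> (0 < n)%N -> (0 < N)%N ->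
  c0 * Num.sqrt N%:R <= n%:R <= (64^-1 : R) * N%:R ->
  (((1024 + c0^-1 ^+ 2) `^ (- p^-1) / 4 * n%:R `^ (- (2 / p)) * N%:R `^ (2 / p - 1))%:E
     <= min_query_err R ('I_N) R (SN R N) (BpN R N p) n)%E.
Proof.
move=> c00 n0 N0 /andP[nN1 nN2].
have nR : 0 < n%:R :> R by rewrite ltr0n.
have NR : 0 < N%:R :> R by rewrite ltr0n.
set b := (X in X%:E).
pose k := (1024 * n ^ 2 %/ N)%N.
have n64 : (64 * n <= N)%N.
  by rewrite -(ler_nat R) natrM; move: nN2; rewrite mulrC ler_pdivlMr// mulrC.
have kN : (4 * k <= N)%N.
  rewrite /k -(leq_pmul2r N0) -mulnA.
  apply: (@leq_trans (4 * (1024 * n ^ 2))); first by rewrite leq_mul2l leq_trunc_div.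
  by apply: (@leq_trans ((64 * n) ^ 2)); [rewrite expnMn; lia | rewrite -mulnn leq_mul].
have kN' : (1024 * n ^ 2 < k.+1 * N)%N by rewrite ltn_ceil.
have kNle : (k * N <= 1024 * n ^ 2)%N by apply: leq_trunc_div.
clearbody k.
pose v : R := (N%:R / k.+1%:R) `^ p^-1.
have v0 : 0 < v by apply: powR_gt0; rewrite divr_gt0.
have C0 : 0 < 1024 + c0^-1 ^+ 2 :> R.
  by apply: ltr_wpDr; [exact: sqr_ge0 | rewrite ltr0n].
have bv : b <= v / N%:R / 4.
  (* Since n is at least c0 sqrt N, the extra 1 in k + 1 costs only a constant factor. *)
  have c2N : N%:R <= c0^-1 ^+ 2 * n%:R ^+ 2.
    rewrite -exprMn -[leLHS]sqr_sqrtr ?ler0n// ler_pXn2r ?nnegrE ?sqrtr_ge0//.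
      by rewrite mulrC ler_pdivlMr// mulrC.
    by rewrite mulr_ge0 ?invr_ge0 ?(ltW c00).
  have kle : k.+1%:R * N%:R <= (1024 + c0^-1 ^+ 2) * n%:R ^+ 2 :> R.
    rewrite mulrDl -addn1 natrD mulrDl mul1r lerD//.
    by move: kNle; rewrite -(ler_nat R) !natrM -expr2.
  rewrite /b -mulrA -(powR_scale p NR nR) mulrAC ler_pM2r// [leLHS]mulrA ler_pM2r ?invr_gt0//.
  have -> : (1024 + c0^-1 ^+ 2) `^ (- p^-1) = (1024 + c0^-1 ^+ 2)^-1 `^ p^-1.
    by rewrite -[X in _ = X `^ _]powR_inv1 ?(ltW C0)// -powRrM mulN1r.
  rewrite -powRM ?invr_ge0 ?(ltW C0) ?divr_ge0 ?sqr_ge0//.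
  rewrite ge0_ler_powR ?nnegrE ?invr_ge0 ?mulr_ge0 ?divr_ge0 ?sqr_ge0 ?invr_ge0 ?(ltW p0) ?(ltW C0)//.
  move: (1024 + _) C0 kle => C C0 kle; rewrite ler_pdivlMr//.
  rewrite [leLHS](_ : _ = N%:R * (k.+1%:R * N%:R) / (C * n%:R ^+ 2)).
    by rewrite ler_pdivrMr ?mulr_gt0 ?exprn_gt0// ler_pM2l.
  by field; rewrite !gt_eqF.
have b0 : 0 < b by rewrite /b !mulr_gt0 ?powR_gt0.
apply: le_ereal_inf_tmp => _ [A /= An <-]; rewrite leNgt; apply/negP => errA.
have fA f : BpN R N p f -> fail_prob (SN R N) A f b <= 1 / 4.
  move=> fB; have : (err_f (SN R N) A f < b%:E)%E.
    by apply: le_lt_trans errA; apply: ereal_sup_ubound; exists f.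
  move=> /ereal_inf_lt[_ [e /= eA <-]]; rewrite lte_fin => eb.
  exact: le_trans (fail_prob_le A (SN R N) f (ltW eb)) eA.
have SNspike X : SN R N (spike v X) = N%:R^-1 * (#|X|%:R * v).
  by rewrite /SN (sum_spike _ _ (g := id)).
have : ((#|'I_N| - k) * k.+1 <= 256 * n ^ 2)%N.
  apply: (@adversary_bound _ _ _ A (SN R N) (@spike N v) k n b) => //.
  - by rewrite card_ord; move: kN N0; clear; lia.
  - by move=> X d dX e ed; rewrite /spike finset.in_setU1 (negbTE ed).
  - move=> X d Xk dX; rewrite !SNspike cardsU1 dX Xk natrD.
    rewrite (_ : _ - _ = - (N%:R^-1 * v)); last by rewrite /=; ring.
    rewrite normrN gtr0_norm ?mulr_gt0 ?invr_gt0//.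
    by move: bv; rewrite (mulrC v); have : 0 < N%:R^-1 * v by [rewrite mulr_gt0 ?invr_gt0]; lra.
  - move=> X Xk; apply: fA; apply: spike_ball => //.
    by case/orP: Xk => /eqP ->.
rewrite card_ord leqNgt => /negP; apply.
have h1 : (N <= 2 * (N - k))%N by move: kN; clear; lia.
have := leq_mul h1 (leqnn k.+1); rewrite -mulnA; move: kN'; rewrite (mulnC k.+1).
by move: (N * _)%N ((N - k) * _)%N (n ^ 2)%N; clear; lia.
Qed.

End LowerBoundSum.

(** * Counting by amplitude estimation *)

Section Walk.
Variables (R : realType) (I : finType) (u o : I -> R).
Hypothesis u_unit : \sum_i u i ^+ 2 = 1.
Hypothesis o_sign : forall i, o i ^+ 2 = 1.

(* The Grover walk, started one step before the vector u: walk 1 = u. *)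
Fixpoint walk (t : nat) (i : I) : R :=
  if t is t'.+1 then 2 * u i * (\sum_j u j * (o j * walk t' j)) - o i * walk t' i
  else o i * u i.

Definition walk_cos : R := \sum_i o i * u i ^+ 2.

Lemma walk0 i : walk 0 i = o i * u i. Proof. by []. Qed.

Lemma walkS t i : walk t.+1 i =
  2 * u i * (\sum_j u j * (o j * walk t j)) - o i * walk t i.
Proof. by []. Qed.

Arguments walk : simpl never.

Lemma walk1 i : walk 1 i = u i.
Proof.
rewrite walkS (eq_bigr (fun j => u j ^+ 2)) => [|j _].
  by rewrite u_unit mulr1 walk0 mulrA -expr2 o_sign mul1r mulr_natl mulr2n addrK.
by rewrite walk0 (mulrA (o j)) -expr2 o_sign mul1r expr2.
Qed.

(** A step is the product of the reflections diag o and 2 u u^T - 1, a rotation on the plane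
    containing the walk. A rotation satisfies the Chebyshev recurrence with its cosine, here
    [walk_cos]. *)
Lemma walk_rec t i : walk t i + walk t.+2 i = 2 * walk_cos * walk t.+1 i.
Proof.
elim: t i => [|t IH] i.
  rewrite (walkS 1); under eq_bigr => j _ do rewrite walk1 mulrCA -expr2.
  by rewrite -/walk_cos walk1 walk0; ring.
rewrite [in RHS](walkS t.+1) (walkS t.+2).
have -> : \sum_j u j * (o j * walk t.+2 j) =
    2 * walk_cos * (\sum_j u j * (o j * walk t.+1 j)) - \sum_j u j * (o j * walk t j).
  rewrite mulr_sumr -sumrB; apply: eq_bigr => j _.
  have -> : walk t.+2 j = 2 * walk_cos * walk t.+1 j - walk t j by rewrite -IH; ring.
  by ring.
have -> : walk t.+2 i = 2 * walk_cos * walk t.+1 i - walk t i by rewrite -IH; ring.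
by rewrite (walkS t); ring.
Qed.

Lemma sum_reflect (x : I -> R) :
  \sum_i (2 * u i * (\sum_j u j * (o j * x j)) - o i * x i) ^+ 2 = \sum_i x i ^+ 2.
Proof.
set s := \sum_j u j * _.
rewrite (eq_bigr (fun i => 4 * s ^+ 2 * u i ^+ 2 - 4 * s * (u i * (o i * x i)) + x i ^+ 2)).
  by rewrite big_split sumrB /= -!mulr_sumr -/s u_unit; ring.
by move=> i _; rewrite (_ : x i ^+ 2 = (o i * x i) ^+ 2); [ring | rewrite exprMn o_sign mul1r].
Qed.

Lemma walk_norm t : \sum_i walk t i ^+ 2 = 1.
Proof.
elim: t => [|t IH]; last by rewrite -IH -[RHS]sum_reflect.
by rewrite -u_unit; apply: eq_bigr => i _; rewrite walk0 exprMn o_sign mul1r.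
Qed.

(** The difference of two walk vectors is moved by the same orthogonal step, so its norm does not
    depend on [t]. *)
Lemma walk_diff_norm t :
  \sum_i (walk t.+2 i - walk t i) ^+ 2 = 4 * (1 - walk_cos ^+ 2).
Proof.
elim: t => [|t IH]; last first.
  rewrite -IH -[RHS]sum_reflect; apply: eq_bigr => i _; congr (_ ^+ 2).
  rewrite (walkS t.+2) (walkS t).
  have -> : \sum_j u j * (o j * (walk t.+2 j - walk t j)) =
      \sum_j u j * (o j * walk t.+2 j) - \sum_j u j * (o j * walk t j).
    by rewrite -sumrB; apply: eq_bigr => j _; ring.
  by ring.
have w2 i : walk 2 i - walk 0 i = 2 * (walk_cos * u i - o i * u i).
  by have := walk_rec 0 i; rewrite walk1 walk0 => H; lra.
rewrite (eq_bigr (fun i => 4 * (walk_cos ^+ 2 + 1) * u i ^+ 2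
                           - 8 * walk_cos * (o i * u i ^+ 2))).
  by rewrite sumrB -!mulr_sumr -/walk_cos u_unit; ring.
move=> i _; rewrite w2 exprMn sqrrB exprMn -mulrA.
by rewrite (exprMn _ (o i)) o_sign; ring.
Qed.

(* s * (M + 1 - s) is a window vanishing at both ends whose second difference
   is constant, so averaging neighbours nearly multiplies by walk_cos. *)
Definition windowed (M s : nat) (i : I) : R := (s%:R * (M.+1%:R - s%:R)) * walk s i.

(** Replacing c w_(s+1) by the mean of its neighbours leaves the window increments M - 2s and M - 2s
    - 2 as coefficients. *)
Lemma windowed_defect M s i : 
  2^-1 * (windowed M s i + windowed M s.+2 i) - walk_cos * windowed M s.+1 i =
  2^-1 * ((M%:R - 2 * s%:R) * (walk s.+2 i - walk s i)) - walk s.+2 i.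
Proof.
rewrite /windowed -!natr1; have H := walk_rec s i.
set c := walk_cos in H *; set w := walk s.+1 i in H *.
have -> : c * ((s%:R + 1) * (M%:R + 1 - (s%:R + 1)) * w) =
  (s%:R + 1) * (M%:R - s%:R) * (2^-1 * (2 * c * w)) by field.
by rewrite -H; field.
Qed.

(** The increment M - 2s is at most M in absolute value. The factor 1 - c^2 is small for small
    counts, which makes these cheaper to estimate. *)
Lemma sum_windowed_defect M s : (s <= M)%N ->
  \sum_i (2^-1 * (windowed M s i + windowed M s.+2 i)
          - walk_cos * windowed M s.+1 i) ^+ 2 <=
  2 * M%:R ^+ 2 * (1 - walk_cos ^+ 2) + 2.
Proof.
move=> sM; under eq_bigr => i _ do rewrite windowed_defect.
apply: (@le_trans _ _ (\sum_i (2^-1 * M%:R ^+ 2 * (walk s.+2 i - walk s i) ^+ 2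
                               + 2 * walk s.+2 i ^+ 2))).
  apply: ler_sum => i _; move: (walk s.+2 i) (walk s.+2 i - _) => a b.
  have sMR : s%:R <= M%:R :> R by rewrite ler_nat.
  have s0 : 0 <= s%:R :> R by [].
  have h : (M%:R - 2 * s%:R) ^+ 2 <= M%:R ^+ 2 :> R by nra.
  apply: (@le_trans _ _ (2^-1 * ((M%:R - 2 * s%:R) ^+ 2 * b ^+ 2) + 2 * a ^+ 2)).
    have := sqr_ge0 (2^-1 * ((M%:R - 2 * s%:R) * b) + a); nra.
  by rewrite lerD2r -mulrA ler_pM2l// ler_wpM2r ?sqr_ge0.
by rewrite big_split /= -!mulr_sumr walk_diff_norm walk_norm; lra.
Qed.

End Walk.
Arguments walk {R I} u o t i : simpl never.

(** [Z] is free so that the induction is on [m] alone; the window has Z = m + 1. *)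
Lemma sum_window (R : realType) (m : nat) (Z : R) :
  \sum_(y < m) (y.+1%:R * (Z - y.+1%:R)) ^+ 2 =
  Z ^+ 2 * (m%:R * (m%:R + 1) * (2 * m%:R + 1) / 6)
  - 2 * Z * (m%:R ^+ 2 * (m%:R + 1) ^+ 2 / 4)
  + m%:R * (m%:R + 1) * (2 * m%:R + 1) * (3 * m%:R ^+ 2 + 3 * m%:R - 1) / 30.
Proof.
elim: m => [|m IH]; first by rewrite big_ord0; field.
by rewrite big_ord_recr /= IH -!natr1; field.
Qed.

(** A mass of order M^5, against M defects of order M^2, is what makes the variance decay like
    M^-2. *)
Lemma sum_window_ge (R : realType) (M : nat) :
  M%:R ^+ 5 <= 30 * \sum_(y < M) (y.+1%:R * (M.+1%:R - y.+1%:R)) ^+ 2 :> R.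
Proof.
rewrite sum_window -natr1; set x : R := M%:R; have x0 : 0 <= x by [].
rewrite [leRHS](_ : _ = x * (x + 1) * (x + 2) * (x ^+ 2 + 2 * x + 2)); last by field.
have e2 : 0 <= x ^+ 2 by apply: sqr_ge0.
have e3 : 0 <= x ^+ 3 by apply: exprn_ge0.
have e4 : 0 <= x ^+ 4 by apply: exprn_ge0.
rewrite [leRHS](_ : _ = x ^+ 5 + (5 * x ^+ 4 + 10 * x ^+ 3 + 10 * x ^+ 2 + 4 * x)).
  by rewrite lerDl; nra.
by ring.
Qed.

(** * Unitaries obtained from real matrices *)

Section RealMatrices.
Variable R : realType.
Local Notation C := (R[i]).
Local Notation toC := (map_mx (real_complex R)).

Lemma sqnorm_real (x : R) : sqnorm (real_complex R x) = x ^+ 2.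
Proof. by rewrite /sqnorm /= expr0n addr0. Qed.

Lemma unitary_real n (A : 'M[R]_n) : A *m A^T = 1%:M -> unitary (toC A).
Proof.
move=> AA; rewrite /unitary -map_mx_comp.
have -> : map_mx (conjc \o real_complex R) A = toC A.
  by apply: eq_map_mx => x; exact: conjc_real.
by rewrite map_trmx -map_mxM AA map_mx1.
Qed.

Lemma reflection_orthogonal n (P : 'M[R]_n) : P *m P = P -> P^T = P ->
  (1%:M - 2 *: P) *m (1%:M - 2 *: P)^T = 1%:M.
Proof.
move=> PP PT; have -> : (1%:M - 2 *: P)^T = 1%:M - 2 *: P.
  by rewrite linearB linearZ /= trmx1 PT.
rewrite mulmxBl mul1mx mulmxBr mulmx1 -scalemxAl -scalemxAr PP.
rewrite [2 *: (2 *: P)]scaler_nat mulr2n opprB addrK.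
by rewrite subrK.
Qed.

(** The Householder reflection along e_b - w, or the identity when this vector is zero. It serves to
    prepare the initial state. *)
Lemma exists_reflection_column n (b : 'I_n) (w : 'cV[R]_n) :
  \sum_i w i 0 ^+ 2 = 1 ->
  exists2 U : 'M[C]_n, unitary U & U *m delta_mx b 0 = toC w.
Proof.
move=> w1; have [->|wb] := eqVneq w (delta_mx b 0).
  exists 1%:M; first by rewrite /unitary map_mx1 trmx1 mulmx1.
  by rewrite mul1mx map_delta_mx.
pose z := delta_mx b 0 - w; pose t := \sum_i z i 0 ^+ 2.
have tE : t = 2 * z b 0.
  transitivity (\sum_i ((i == b)%:R * (1 - 2 * w i 0) + w i 0 ^+ 2)).
    apply: eq_bigr => i _; rewrite !mxE eqxx andbT; case: (i == b); rewrite /=; ring.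
  rewrite big_split /= w1 (bigD1 b)//= eqxx big1 => [|i /negbTE ->]; last by rewrite mul0r.
  by rewrite !mxE !eqxx /=; ring.
have t0 : t != 0.
  apply: contraNneq wb => /eqP; rewrite psumr_eq0 => [/allP z0|i _]; last exact: sqr_ge0.
  apply/eqP/matrixP => i j; rewrite ord1.
  have := z0 i (mem_index_enum i); rewrite sqrf_eq0 !mxE subr_eq0 => /eqP.
  exact: esym.
pose P := t^-1 *: (z *m z^T).
have zz : z^T *m z = t%:M.
  apply/matrixP => i j; rewrite !ord1 !mxE eqxx mulr1n; apply: eq_bigr => k _.
  by rewrite mxE expr2.
exists (toC (1%:M - 2 *: P)).
  apply/unitary_real/reflection_orthogonal.
    rewrite -scalemxAl -scalemxAr -mulmxA (mulmxA z^T) zz mul_scalar_mx -scalemxAr.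
    by rewrite !scalerA mulVf// mulr1.
  by rewrite /P linearZ /= trmx_mul trmxK.
rewrite -(map_delta_mx (real_complex R)) -map_mxM; congr toC.
rewrite mulmxBl mul1mx -!scalemxAl -mulmxA.
have -> : z^T *m delta_mx b 0 = (z b 0)%:M.
  by apply/matrixP => i j; rewrite !ord1 -colE !mxE eqxx mulr1n.
rewrite mul_mx_scalar !scalerA mulrAC -tE mulfV// scale1r.
by rewrite /z opprB addrC subrK.
Qed.

(** The form in which an observable is measured: apply [P], read the outcome [i] and report the
    eigenvalue [l i]. *)
Lemma spectral_symmetric n (A : 'M[R]_n) : A^T = A ->
  exists (P : 'M[C]_n) (l : 'I_n -> R), unitary P /\
    forall (phi : 'cV[C]_n) i,
      (P *m (toC A *m phi)) i 0 = real_complex R (l i) * (P *m phi) i 0.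
Proof.
move=> AT; pose B := toC A.
have Breal : B \is a realmx.
  by apply/mxOverP => i j; rewrite mxE; apply/CrealP; exact: conjc_real.
have Bsym : B \is symmetricmx.
  by apply/is_hermitianmxP; rewrite expr0 scale1r map_mx_id// map_trmx AT.
have Bherm := realsym_hermsym Bsym Breal.
have /orthomx_spectralP BE := hermitian_normalmx Bherm.
have /mxOverP lreal := hermitian_spectral_diag_real Bherm.
have Punit := spectral_unitarymx B.
exists (spectralmx B), (fun i => complex.Re (spectral_diag B 0 i)); split.
  have /unitarymxP := Punit; rewrite /unitary map_trmx.
  have -> //: map_mx conjc (spectralmx B)^T = map_mx Num.conj (spectralmx B)^T.
  by apply: eq_map_mx => x.
move=> phi i; rewrite -/B mulmxA.
have -> : spectralmx B *m B = diag_mx (spectral_diag B) *m spectralmx B.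
  by rewrite {2}BE !mulmxA mulmxV ?mul1mx// spectral_unit.
rewrite -mulmxA mul_diag_mx mxE; congr (_ * _).
have : conjc (spectral_diag B 0 i) = spectral_diag B 0 i by apply/CrealP.
case: (spectral_diag B 0 i) => x y [] /= /eqP.
by rewrite -subr_eq0 -opprD oppr_eq0 -mulr2n mulrn_eq0 /= => /eqP ->.
Qed.

Lemma vrip_real n (phi psi : 'cV[R]_n) :
  vrip (toC phi) (toC psi) = \sum_i phi i 0 * psi i 0.
Proof. by apply: eq_bigr => i _; rewrite !mxE /rip /= mul0r addr0. Qed.

Lemma unitary_sign n (s : 'I_n -> R) : (forall i, s i ^+ 2 = 1) ->
  unitary (toC (diag_mx (\row_i s i))).
Proof.
move=> s1; apply: unitary_real; rewrite tr_diag_mx mulmx_diag.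
by apply/matrixP => i j; rewrite !mxE -expr2 s1.
Qed.

End RealMatrices.

Section QueryCode.
Variables (D K : Type) (Q : query D K).
Let r := (q_m Q - q_m1 Q - q_m2 Q)%N.

Definition qvalo (k : 'I_(2 ^ q_m Q)) : 'I_(2 ^ q_m2 Q) :=
  Ordinal (ltn_pmod (k %/ 2 ^ r) (expn_gt0 2 (q_m2 Q)) : (qvalue Q k < _)%N).
Definition qresto (k : 'I_(2 ^ q_m Q)) : 'I_(2 ^ r) :=
  Ordinal (ltn_pmod k (expn_gt0 2 r) : (qrest Q k < _)%N).

Lemma qcode_lt (i : 'I_(2 ^ q_m1 Q)) (x : 'I_(2 ^ q_m2 Q)) (y : 'I_(2 ^ r)) :
  (i * (2 ^ q_m2 Q * 2 ^ r) + x * 2 ^ r + y < 2 ^ q_m Q)%N.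
Proof. by rewrite [ltnRHS]q_m_split digits_lt. Qed.

Definition qcode i x y : 'I_(2 ^ q_m Q) := Ordinal (qcode_lt i x y).

Lemma qcodeK i x y :
  [/\ qord (qcode i x y) = i, qvalo (qcode i x y) = x & qresto (qcode i x y) = y].
Proof.
have [Ei Ex Ey] := @qindex_digits _ _ Q i x y (ltn_ord x) (ltn_ord y).
by split; apply: val_inj; rewrite /= ?Ei ?Ex ?Ey.
Qed.

Lemma qcode_qord k : qcode (qord k) (qvalo k) (qresto k) = k.
Proof. by apply: val_inj; rewrite /= qdigitsE. Qed.

Lemma sum_qcode (V : nmodType) (F : 'I_(2 ^ q_m Q) -> V) :
  \sum_k F k = \sum_i \sum_x \sum_y F (qcode i x y).
Proof.
rewrite pair_bigA pair_bigA /=.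
rewrite (reindex (fun u : 'I__ * 'I__ * 'I__ => qcode u.1.1 u.1.2 u.2))//=.
exists (fun k => (qord k, qvalo k, qresto k)) => [[[i x] y]|k] _ /=.
  by have [-> -> ->] := qcodeK i x y.
exact: qcode_qord.
Qed.

Lemma qmap_out (f : D -> K) k : qord k \notin q_Z Q -> qmap Q f k = k.
Proof. by move=> kZ; apply: val_inj; rewrite /= qmapE (negbTE kZ). Qed.

Lemma qmap_digits (f : D -> K) k : qord k \in q_Z Q ->
  qvalue Q (qmap Q f k) = ((qvalue Q k + q_beta Q (f (q_tau Q (qord k)))) %% 2 ^ q_m2 Q)%N.
Proof.
move=> kZ; rewrite qmapE kZ.
by case: (@qindex_digits _ _ Q (qindex Q k)
  ((qvalue Q k + q_beta Q (f (q_tau Q (qord k)))) %% 2 ^ q_m2 Q) (qrest Q k));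
  rewrite ?ltn_mod ?expn_gt0.
Qed.

Lemma qresto_qmap (f : D -> K) k : qresto (qmap Q f k) = qresto k.
Proof.
apply: val_inj => /=; rewrite qmapE; case: ifP => // _.
by case: (@qindex_digits _ _ Q (qindex Q k)
  ((qvalue Q k + q_beta Q (f (q_tau Q (qord k)))) %% 2 ^ q_m2 Q) (qrest Q k));
  rewrite ?ltn_mod ?expn_gt0.
Qed.

End QueryCode.
Arguments qvalo : simpl never.
Arguments qresto : simpl never.
Arguments qord : simpl never.

Lemma sum_delta_ord (V : nmodType) M a (g : nat -> V) :
  \sum_(y < M) (if y == a :> nat then g y else 0) = if (a < M)%N then g a else 0.
Proof.
rewrite -big_mkcond /=; case: ifP => aM.
  by rewrite (eq_bigl (pred1 (Ordinal aM))) ?big_pred1_eq.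
by rewrite big_pred0// => y; apply: contraFF aM => /eqP <-.
Qed.

(** * The counting circuit *)

Section CountingStage.
Variables (R : realType) (N : nat) (N_gt0 : (0 < N)%N).
Variables (m1 r : nat) (m1_gt0 : (0 < m1)%N) (N_le : (N <= 2 ^ m1)%N).
Variable W : R -> bool.
Local Notation C := (R[i]).
Local Notation toC := (map_mx (real_complex R)).

Lemma bit_lt (v : R) : (W v < 2 ^ 1)%N. Proof. by case: (W v). Qed.

Definition counting_tau (i : 'I_(2 ^ m1)) : 'I_N := insubd (Ordinal N_gt0) (i : nat).

Lemma counting_le : (m1 + 1 <= m1 + 1 + r)%N. Proof. exact: leq_addr. Qed.

Definition counting_Z : {set 'I_(2 ^ m1)} := finset (fun i : 'I_(2 ^ m1) => (i < N)%N).

Lemma counting_Z_ne : (0 < #|counting_Z|)%N.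
Proof.
apply/card_gt0P; exists (Ordinal (leq_trans N_gt0 N_le)).
by rewrite finset.in_set.
Qed.

(** The value register is one qubit, receiving the bit [W v], and the [r] qubits that the query
    leaves alone hold the counter. Addresses from N on are padding, kept out by [counting_Z]. *)
Definition counting_query : query 'I_N R :=
  @Query 'I_N R (m1 + 1 + r) m1 1 m1_gt0 isT counting_le counting_Z counting_Z_ne
    counting_tau (fun v => Ordinal (bit_lt v)).

Local Notation Q := counting_query.
Local Notation T := ('I_(2 ^ q_m Q)).
Local Notation code := (@qcode _ _ Q).
(** Kept in the shape of the bound of [qresto], so that the ordinal types agree. *)
Definition counter_size : nat := (2 ^ (q_m Q - q_m1 Q - q_m2 Q))%N.
Local Notation M := counter_size.

Lemma counter_sizeE : M = (2 ^ r)%N.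
Proof. by rewrite /M /=; congr (_ ^ _)%N; lia. Qed.

Let M_gt0 : (0 < M)%N. Proof. by rewrite /M expn_gt0. Qed.
Let MR : 0 < M%:R :> R. Proof. by rewrite ltr0n. Qed.
Let NR : 0 < N%:R :> R. Proof. by rewrite ltr0n. Qed.

Definition uniform (i : 'I_(2 ^ m1)) : R :=
  if (i < N)%N then (Num.sqrt N%:R)^-1 else 0.

Definition window_mass : R := \sum_(y < M) (y.+1%:R * (M.+1%:R - y.+1%:R)) ^+ 2.
Local Notation S := window_mass.

Let S_ge : M%:R ^+ 5 <= 30 * S. Proof. exact: sum_window_ge. Qed.

Let S_gt0 : 0 < S.
Proof.
have : 0 < 30 * S by apply: lt_le_trans S_ge; rewrite exprn_gt0.
by rewrite pmulr_rgt0.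
Qed.

(** The 2 normalises the value qubit, whose two entries are 1 or -1. *)
Definition window_norm : R := (Num.sqrt (2 * S))^-1.
Local Notation nrm := window_norm.

Let nrm2 : nrm ^+ 2 = (2 * S)^-1.
Proof. by rewrite exprVn sqr_sqrtr// mulr_ge0// ltW. Qed.

Variable f : 'I_N -> R.

Definition oracle_sign (i : 'I_(2 ^ m1)) : R :=
  if (i < N)%N && W (f (counting_tau i)) then -1 else 1.

Definition marked : nat := (\sum_(i < N) W (f i))%N.

Lemma sum_lt_N (g : 'I_N -> R) :
  \sum_(i < 2 ^ m1) (if (i < N)%N then g (counting_tau i) else 0) = \sum_i g i.
Proof.
rewrite -big_mkcond /= [RHS](eq_bigr (fun i : 'I_N => g (insubd (Ordinal N_gt0) (i : nat)))).
  rewrite -(big_mkord xpredT (fun i => g (insubd (Ordinal N_gt0) i))).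
  by rewrite (big_nat_widen _ _ (2 ^ m1))// big_mkord.
by move=> i _; rewrite valKd.
Qed.

Lemma uniform_sqr i : uniform i ^+ 2 = if (i < N)%N then N%:R^-1 else 0.
Proof.
rewrite /uniform; case: ifP => _; last by rewrite expr0n.
by rewrite exprVn sqr_sqrtr// ler0n.
Qed.

Lemma uniform_unit : \sum_i uniform i ^+ 2 = 1.
Proof.
under eq_bigr => i _ do rewrite uniform_sqr.
rewrite (sum_lt_N (fun=> N%:R^-1)) sumr_const card_ord -[LHS]mulr_natl mulfV//.
by rewrite gt_eqF.
Qed.

Lemma oracle_sign_sqr i : oracle_sign i ^+ 2 = 1.
Proof. by rewrite /oracle_sign; case: ifP => _; rewrite ?sqrrN expr1n. Qed.

Local Notation c := (walk_cos uniform oracle_sign).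

Lemma walk_cosE : c = 1 - 2 * marked%:R / N%:R.
Proof.
rewrite /walk_cos (eq_bigr (fun i : 'I_(2 ^ m1) => if (i < N)%N then
   N%:R^-1 - 2 / N%:R * (W (f (counting_tau i)))%:R else 0)) => [|i _]; last first.
  rewrite uniform_sqr /oracle_sign; case: (i < N)%N => /=; last by rewrite mulr0.
  by case: (W _); rewrite /=; field; rewrite gt_eqF.
rewrite (sum_lt_N (fun i => N%:R^-1 - 2 / N%:R * (W (f i))%:R)) sumrB -mulr_sumr.
rewrite sumr_const card_ord -[X in X - _]mulr_natl mulfV ?gt_eqF// -natr_sum.
by rewrite mulrAC.
Qed.

Local Notation w := (walk uniform oracle_sign).

(** The state after U_j. On counter value y the walk advances y times and then rests: the value
    qubit is |-> while j < y, which turns a query into the phase [oracle_sign], and |+> afterwards,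
    on which a query acts trivially. *)
Definition counting_state (j : nat) : 'cV[R]_(2 ^ q_m Q) :=
  \col_(k < 2 ^ q_m Q) (nrm * ((qresto k).+1%:R * (M.+1%:R - (qresto k).+1%:R))
   * w (minn j (qresto k)).+1 (qord k)
   * (if (j < qresto k)%N then (-1) ^+ qvalo k else 1)).

Definition queried_state (j : nat) : 'cV[R]_(2 ^ q_m Q) :=
  \col_(k < 2 ^ q_m Q) (nrm * ((qresto k).+1%:R * (M.+1%:R - (qresto k).+1%:R))
   * w (minn j (qresto k)).+1 (qord k)
   * (if (j < qresto k)%N then (-1) ^+ qvalo k * oracle_sign (qord k) else 1)).

Lemma sign_mod2 n : (-1) ^+ (n %% 2) = (-1) ^+ n :> R.
Proof. by rewrite modn2 signr_odd. Qed.

(** Phase kickback: adding a bit to |-> multiplies it by the sign of the bit and fixes |+>. *)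
Lemma query_counting_state j :
  query_mx Q f *m toC (counting_state j) = toC (queried_state j).
Proof.
apply/matrixP => k0 z; rewrite ord1 {z} -(f_invF (@qmap_inj _ _ Q f) k0).
set k := invF _ _; rewrite query_mxE !mxE; congr (real_complex R _).
rewrite qindex_qmap qresto_qmap; congr (_ * _); case: ifP => // _.
rewrite /oracle_sign; case: ifP => [/andP[kZ Wk]|]; last first.
  move/negbT; rewrite negb_and => kZW; rewrite mulr1; congr (_ ^+ _).
  have [kZ|kZ] := boolP (qord k \in q_Z Q); last first.
    by rewrite qmap_out.
  apply: etrans (esym (qmap_digits f kZ)); move: kZ; rewrite finset.in_set => kZ.
  move: kZW; rewrite kZ /= => /negbTE ->; rewrite addn0 modn_small//.
  exact: (ltn_ord (qvalo k)).
have kZ' : qord k \in q_Z Q by rewrite finset.in_set.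
rewrite (qmap_digits f kZ' : nat_of_ord (qvalo (qmap Q f k)) = _) /= Wk.
by rewrite (sign_mod2 (qvalue Q k + true)) exprD expr1 -mulrA mulrNN !mulr1.
Qed.

(** For every value bit and every counter value from [t] on, the projection of the address register
    onto the uniform state. *)
Definition fiber_proj (t : nat) : 'M[R]_(2 ^ q_m Q) :=
  \matrix_(k < 2 ^ q_m Q, k' < 2 ^ q_m Q) (if [&& (t <= qresto k)%N, qvalo k == qvalo k' & qresto k == qresto k']
                   then uniform (qord k) * uniform (qord k') else 0).

Lemma sum_fiber_proj t k (F : T -> R) :
  \sum_k' fiber_proj t k k' * F k' =
  if (t <= qresto k)%N then
    uniform (qord k) * \sum_i uniform i * F (code i (qvalo k) (qresto k)) else 0.
Proof.
have E k' : fiber_proj t k k' * F k' = if (t <= qresto k)%N then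
    (if (qvalo k == qvalo k') && (qresto k == qresto k')
     then uniform (qord k) * (uniform (qord k') * F k') else 0) else 0.
  by rewrite mxE; do 3?[case: (_ == _) | case: (_ <= _)%N]; rewrite /= ?mul0r ?mulrA.
rewrite (eq_bigr _ (fun k' _ => E k')); case: ifP => _; last by rewrite big1.
rewrite sum_qcode mulr_sumr; apply: eq_bigr => i _.
rewrite (bigD1 (qvalo k))//= [X in _ + X]big1 => [|x xk]; last first.
  rewrite big1// => y _; have [_ -> _] := qcodeK (Q := Q) i x y.
  by rewrite eq_sym (negbTE xk).
rewrite addr0 (bigD1 (qresto k))//= [X in _ + X]big1 => [|y yk]; last first.
  have [_ _ ->] := qcodeK (Q := Q) i (qvalo k) y.
  by rewrite [qresto k == y]eq_sym (negbTE yk) andbF.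
by have [-> -> ->] := qcodeK (Q := Q) i (qvalo k) (qresto k); rewrite !eqxx addr0.
Qed.

Lemma fiber_proj_idem t : fiber_proj t *m fiber_proj t = fiber_proj t.
Proof.
apply/matrixP => k k'; rewrite mxE sum_fiber_proj [RHS]mxE.
case: (leqP t (qresto k)) => tk //=.
under eq_bigr => i _.
  rewrite mxE; have [-> -> ->] := qcodeK (Q := Q) i (qvalo k) (qresto k).
  by rewrite tk /=; over.
case: ifP => _; last by rewrite big1 ?mulr0// => i _; rewrite mulr0.
under eq_bigr => i _ do rewrite mulrA -expr2.
by rewrite -mulr_suml uniform_unit mul1r.
Qed.

Lemma fiber_proj_sym t : (fiber_proj t)^T = fiber_proj t.
Proof.
apply/matrixP => k k'; rewrite !mxE (eq_sym (qvalo k')) (eq_sym (qresto k')).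
case: eqP => _; rewrite ?andbF//; case: eqP => [->|_]; rewrite ?andbF//.
by rewrite mulrC.
Qed.

(* Reflects about the uniform state where the counter is at least t, and
   moves the value qubit from |-> to |+> where the counter equals t. *)
Definition counting_sign (t : nat) (k : T) : R :=
  (if (t <= qresto k)%N then -1 else 1) * (if t == qresto k :> nat then (-1) ^+ qvalo k else 1).

Definition counting_step (t : nat) : 'M[C]_(2 ^ q_m Q) :=
  toC (diag_mx (\row_k counting_sign t k)) *m toC (1%:M - 2 *: fiber_proj t).

Lemma counting_step_unitary t : unitary (counting_step t).
Proof.
apply: unitaryM.
  apply: unitary_sign => k; rewrite /counting_sign exprMn.
  by do 2!case: ifP => _; rewrite ?sqrrN ?expr1n ?mulr1 ?mul1r // -exprM mulnC exprM sqrrN expr1n expr1n.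
by apply/unitary_real/reflection_orthogonal; [exact: fiber_proj_idem | exact: fiber_proj_sym].
Qed.

Lemma counting_step_state j :
  counting_step j.+1 *m toC (queried_state j) = toC (counting_state j.+1).
Proof.
rewrite /counting_step -mulmxA -!map_mxM; congr toC.
apply/matrixP => k z; rewrite ord1 {z} mul_diag_mx !mxE.
under eq_bigr => k' _.
  have -> : ((1%:M - 2 *: fiber_proj j.+1) k k' * queried_state j k' 0 =
    (k == k')%:R * queried_state j k' 0 - 2 * (fiber_proj j.+1 k k' * queried_state j k' 0)).
    by rewrite !mxE; ring.
  over.
rewrite sumrB -mulr_sumr sum_fiber_proj (bigD1 k)//= eqxx mul1r.
rewrite [X in _ + X - _]big1 => [|k' kk']; last by rewrite eq_sym (negbTE kk') mul0r.
rewrite addr0 !mxE /counting_sign.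
case: (ltnP j (qresto k)) => jy.
  have mj : minn j (qresto k) = j by apply/minn_idPl; exact: ltnW.
  have mj1 : minn j.+1 (qresto k) = j.+1 by apply/minn_idPl.
  rewrite ?mj mj1 [w j.+2 _]walkS.
  set a := nrm * _; set s := (-1) ^+ qvalo k.
  have -> : \sum_i uniform i * queried_state j (code i (qvalo k) (qresto k)) 0 =
     a * s * \sum_i uniform i * (oracle_sign i * w j.+1 i).
    rewrite mulr_sumr; apply: eq_bigr => i _; rewrite mxE.
    have [-> -> ->] := qcodeK (Q := Q) i (qvalo k) (qresto k).
    by rewrite jy mj -/a -/s; ring.
  have ss : s * s = 1 by rewrite /s -expr2 -exprM mulnC exprM sqrrN !expr1n.
  set G := \sum_i uniform i * (oracle_sign i * _).
  (* When j + 1 equals the counter the walk has made its last step: the value qubit turns from |->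
     to |+>, and the sign [s] cancels against itself. *)
  have [jk|jk] := eqVneq j.+1 (qresto k : nat).
    have -> : (j.+1 < qresto k)%N = false by rewrite jk ltnn.
    transitivity ((s * s) * (a * (2 * uniform (qord k) * G -
       oracle_sign (qord k) * w j.+1 (qord k)))); first by ring.
    by rewrite ss mul1r mulr1.
  rewrite ltn_neqAle jk jy /=; ring.
have mj : minn j (qresto k) = qresto k by apply/minn_idPr.
have mj1 : minn j.+1 (qresto k) = qresto k by apply/minn_idPr; exact: leqW.
rewrite ?mj mj1 ltnNge (leqW jy) /= (gtn_eqF (n := j.+1)); last by rewrite ltnS.
by rewrite !mul1r !mulr1 mulr0 subr0.
Qed.

Definition initial_state : 'cV[R]_(2 ^ q_m Q) :=
  \col_(k < 2 ^ q_m Q) (nrm * ((qresto k).+1%:R * (M.+1%:R - (qresto k).+1%:R))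
   * uniform (qord k) * (if (0 < qresto k)%N then (-1) ^+ qvalo k else 1)).

(** Since [walk 1] is the uniform vector, the starting state does not depend on [f] and can be
    prepared without a query. *)
Lemma counting_state0 : counting_state 0 = initial_state.
Proof.
apply/matrixP => k z; rewrite !mxE min0n walk1//.
  exact: uniform_unit.
exact: oracle_sign_sqr.
Qed.

Lemma sum_code (F : 'I_(2 ^ m1) -> nat -> R) :
  \sum_(k < 2 ^ q_m Q) nrm ^+ 2 * F (qord k) (qresto k) =
  S^-1 * \sum_(y < M) \sum_i F i y.
Proof.
rewrite sum_qcode [X in _ = _ * X]exchange_big mulr_sumr; apply: eq_bigr => i _.
rewrite exchange_big mulr_sumr; apply: eq_bigr => y _.
under eq_bigr => x _.
  have [-> _ ->] := qcodeK (Q := Q) i x y; over.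
rewrite sumr_const card_ord nrm2 -mulrnAl; congr (_ * _).
by rewrite /= -mulr_natl; field; rewrite gt_eqF.
Qed.

Lemma initial_state_unit : \sum_k initial_state k 0 ^+ 2 = 1.
Proof.
rewrite -[RHS](mulVf (lt0r_neq0 S_gt0)).
transitivity (S^-1 * \sum_(y < M) \sum_i
    (y.+1%:R * (M.+1%:R - y.+1%:R)) ^+ 2 * uniform i ^+ 2); last first.
  by congr (_ * _); apply: eq_bigr => y _; rewrite -mulr_sumr uniform_unit mulr1.
rewrite -(sum_code (fun i y => (y.+1%:R * (M.+1%:R - y.+1%:R)) ^+ 2 * uniform i ^+ 2)).
apply: eq_bigr => k _; rewrite mxE !exprMn; set s := if _ then _ else _.
have -> : s ^+ 2 = 1.
  by rewrite /s; case: ifP; rewrite ?expr1n // -exprM mulnC exprM sqrrN !expr1n.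
by rewrite mulr1 -!mulrA.
Qed.

(* The observable measured at the end. Averaging over neighbouring counter
   values nearly multiplies the final state by the cosine of the walk, so its
   outcome estimates that cosine. *)
Definition counter_path : 'M[R]_(2 ^ q_m Q) :=
  \matrix_(k < 2 ^ q_m Q, k' < 2 ^ q_m Q)
    (if (qord k == qord k') && (qvalo k == qvalo k') then
       2^-1 * ((if qresto k' == (qresto k).+1 :> nat then 1 else 0) +
               (if qresto k == (qresto k').+1 :> nat then 1 else 0)) else 0).

Lemma counter_path_sym : counter_path^T = counter_path.
Proof.
apply/matrixP => k k'; rewrite !mxE (eq_sym (qord k')) (eq_sym (qvalo k')).
by case: ifP => // _; rewrite addrC.
Qed.

Lemma sum_counter_path k (F : T -> R) :
  \sum_k' counter_path k k' * F k' =
  2^-1 * (\sum_(y < M) (if y == (qresto k).+1 :> nat then F (code (qord k) (qvalo k) y) else 0)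
        + \sum_(y < M) (if qresto k == y.+1 :> nat then F (code (qord k) (qvalo k) y) else 0)).
Proof.
rewrite sum_qcode (bigD1 (qord k))//= [X in _ + X]big1 => [|i ik]; last first.
  rewrite big1// => x _; rewrite big1// => y _; rewrite mxE.
  by have [-> _ _] := qcodeK (Q := Q) i x y; rewrite eq_sym (negbTE ik) mul0r.
rewrite addr0 (bigD1 (qvalo k))//= [X in _ + X]big1 => [|x xk]; last first.
  rewrite big1// => y _; rewrite mxE.
  have [_ -> _] := qcodeK (Q := Q) (qord k) x y.
  by rewrite [qvalo k == x]eq_sym (negbTE xk) andbF mul0r.
rewrite addr0 -big_split mulr_sumr; apply: eq_bigr => y _; rewrite mxE.
have [-> -> ->] := qcodeK (Q := Q) (qord k) (qvalo k) y; rewrite !eqxx /=.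
by do 2!case: ifP => _; rewrite ?mul1r ?mul0r ?addr0 ?add0r ?mulr0 ?mul0r -?mulrA ?mul1r ?mulrDl ?mul1r.
Qed.

(** Counter values are at most M - 1, so after M - 1 queries every branch rests and the value qubit
    is |+>. *)
Lemma final_stateE k :
  counting_state M.-1 k 0 = nrm * windowed uniform oracle_sign M (qresto k).+1 (qord k).
Proof.
have yM : (qresto k <= M.-1)%N by rewrite -ltnS prednK// ltn_ord.
rewrite mxE /windowed; have -> : minn M.-1 (qresto k) = qresto k by apply/minn_idPr.
by rewrite ltnNge yM mulr1 -[LHS]mulrA.
Qed.

(** The neighbours missing at the two ends of the path cause no boundary term, because the window
    vanishes at 0 and M + 1. *)
Lemma counter_path_final k :
  (counter_path *m counting_state M.-1) k 0 = nrm * (2^-1 *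
    (windowed uniform oracle_sign M (qresto k) (qord k)
     + windowed uniform oracle_sign M (qresto k).+2 (qord k))).
Proof.
rewrite mxE sum_counter_path mulrCA; congr (_ * _); rewrite addrC mulrDr.
pose h y := nrm * windowed uniform oracle_sign M y.+1 (qord k).
have hE y : counting_state M.-1 (code (qord k) (qvalo k) y) 0 = h y.
  by rewrite final_stateE; have [-> _ ->] := qcodeK (Q := Q) (qord k) (qvalo k) y.
congr (_ + _).
  rewrite (eq_bigr (fun y : 'I_M => if (y == (qresto k).-1 :> nat) && (0 < qresto k)%N then h y else 0)).
    case: (posnP (qresto k)) => [->|y0].
      by rewrite big1 => [|y _]; rewrite ?andbF// /windowed !mul0r mulr0.
    under eq_bigr => y _ do rewrite andbT.
    rewrite sum_delta_ord (leq_ltn_trans (leq_pred _) (ltn_ord (qresto k))).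
    by rewrite /h prednK.
  move=> y _; rewrite hE; congr (if _ then _ else _).
  by case: (nat_of_ord (qresto k)) => [|q]; rewrite ?andbF ?andbT//= eqSS eq_sym.
under eq_bigr => y _ do rewrite hE.
rewrite sum_delta_ord; case: ifPn => // yM.
have -> : (qresto k).+2 = M.+1.
  by congr _.+1; apply/eqP; rewrite eqn_leq ltn_ord leqNgt.
by rewrite /windowed subrr mulr0 !mul0r mulr0.
Qed.

Lemma counter_path_defect :
  \sum_k ((counter_path *m counting_state M.-1) k 0 - c * counting_state M.-1 k 0) ^+ 2
    <= 60 * (1 - c ^+ 2) / M%:R ^+ 2 + 60 / M%:R ^+ 4.
Proof.
pose F i y := (2^-1 * (windowed uniform oracle_sign M y i
    + windowed uniform oracle_sign M y.+2 i) - c * windowed uniform oracle_sign M y.+1 i) ^+ 2.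
rewrite (eq_bigr (fun k : T => nrm ^+ 2 * F (qord k) (qresto k))) => [|k _]; last first.
  by rewrite counter_path_final final_stateE (mulrCA c) -mulrBr exprMn.
rewrite sum_code.
apply: (@le_trans _ _ (S^-1 * \sum_(y < M) (2 * M%:R ^+ 2 * (1 - c ^+ 2) + 2))).
  rewrite ler_pM2l ?invr_gt0//; apply: ler_sum => y _.
  by apply: sum_windowed_defect; [exact: uniform_unit | exact: oracle_sign_sqr | exact: ltnW].
rewrite sumr_const card_ord -[X in _ * X]mulr_natl mulrC ler_pdivrMr//.
have c1 : 0 <= 1 - c ^+ 2.
  have := walk_diff_norm uniform_unit oracle_sign_sqr 0.
  have : 0 <= \sum_i (w 2 i - w 0 i) ^+ 2 by apply: sumr_ge0 => i _; exact: sqr_ge0.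
  by move=> + E; rewrite E pmulr_rge0.
apply: (@le_trans _ _ ((2 * (1 - c ^+ 2) / M%:R ^+ 2 + 2 / M%:R ^+ 4) * M%:R ^+ 5)).
  by rewrite le_eqVlt; apply/orP; left; apply/eqP; field; rewrite gt_eqF.
have B0 : 0 <= 2 * (1 - c ^+ 2) / M%:R ^+ 2 + 2 / M%:R ^+ 4.
  by rewrite addr_ge0 ?divr_ge0 ?mulr_ge0 ?exprn_ge0.
apply: le_trans (ler_wpM2l B0 S_ge) _.
by rewrite le_eqVlt; apply/orP; left; apply/eqP; field; rewrite gt_eqF.
Qed.

End CountingStage.

Section CountingAlgorithm.
Variables (R : realType) (N : nat) (N_gt0 : (0 < N)%N).
Variables (m1 r : nat) (m1_gt0 : (0 < m1)%N) (N_le : (N <= 2 ^ m1)%N).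
Variable W : R -> bool.
Local Notation C := (R[i]).
Local Notation toC := (map_mx (real_complex R)).
Local Notation Q := (@counting_query R N N_gt0 m1 r m1_gt0 N_le W).
Local Notation M := (2 ^ r)%N.

Variables (P U0 : 'M[C]_(2 ^ q_m Q)).
Hypotheses (P_unitary : unitary P) (U0_unitary : unitary U0).
Let b0 : 'I_(2 ^ q_m Q) := Ordinal (expn_gt0 2 (q_m Q) : (0 < 2 ^ q_m Q)%N).
Hypothesis U0_initial :
  U0 *m delta_mx b0 0 = toC (initial_state N_gt0 r m1_gt0 N_le W).

(** The basis change [P] is merged into the last unitary, which is also the first one when r = 0. *)
Definition counting_unitary (j : nat) : 'M[C]_(2 ^ q_m Q) :=
  (if j == M.-1 then P else 1%:M) *m
  (if j is 0 then U0 else counting_step N_gt0 r m1_gt0 N_le W j).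

Lemma counting_unitaryP j : (j <= M.-1)%N -> unitary (counting_unitary j).
Proof.
move=> _; apply: unitaryM.
  by case: ifP => // _; rewrite /unitary map_mx1 trmx1 mulmx1.
by case: j => [|j] //; exact: counting_step_unitary.
Qed.

Definition counting_alg : alg0 R 'I_N R :=
  @Alg0 R 'I_N R Q M.-1 counting_unitary counting_unitaryP.

Lemma counting_prod (f : 'I_N -> R) j : (j <= M.-1)%N ->
  alg0_prod counting_alg f j *m delta_mx b0 0 =
  (if j == M.-1 then P else 1%:M) *m toC (counting_state N_gt0 r m1_gt0 N_le W f j).
Proof.
elim: j => [|j IH] jM.
  by rewrite /= /counting_unitary -mulmxA U0_initial counting_state0.
have -> : alg0_prod counting_alg f j.+1 =
  counting_unitary j.+1 *m query_mx Q f *m alg0_prod counting_alg f j by [].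
rewrite -(mulmxA _ _ (delta_mx _ _)) IH; last exact: ltnW.
rewrite (ltn_eqF jM) mul1mx -mulmxA query_counting_state /counting_unitary -mulmxA.
by rewrite counting_step_state.
Qed.

End CountingAlgorithm.

Lemma exists_nearest (R : realType) (N : nat) (x : R) :
  exists t : nat, (t <= N)%N /\
    forall t', (t' <= N)%N -> `|x - t%:R| <= `|x - t'%:R|.
Proof.
have [t _ tmin] := arg_minP (fun t : 'I_N.+1 => `|x - t%:R|) (i0 := ord0) (P := xpredT) isT.
exists t; split; first by rewrite -ltnS.
by move=> t' t'N; exact: (tmin (Ordinal (t'N : (t' < N.+1)%N))).
Qed.

(** Unitarity of [P] turns the mean-square error of the measured eigenvalue into the squared norm
    bounded by [counter_path_defect]. The count is N (1 - c) / 2. Rounding at most doubles the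
    error, as the true count is a candidate, and this 2 cancels the 1/2. Finally 1 - c^2 is at most
    4 count / N. *)
Lemma counting_stage (R : realType) (N m1 r : nat) (W : R -> bool) :
  (0 < N)%N -> (0 < m1)%N -> (N <= 2 ^ m1)%N ->
  exists (A : alg0 R 'I_N R) (est : nat -> nat), a_n A = (2 ^ r).-1 /\
    forall f : 'I_N -> R,
      \sum_(k < 2 ^ alg0_qubits A)
         sqnorm (entry (alg0_mx A f) k 0) * ((est k)%:R - (\sum_(i < N) W (f i))%N%:R) ^+ 2
      <= 240 * N%:R * (\sum_(i < N) W (f i))%N%:R / (2 ^ r)%:R ^+ 2
         + 60 * N%:R ^+ 2 / (2 ^ r)%:R ^+ 4.
Proof.
move=> N0 m0 Nm.
have NR : 0 < N%:R :> R by rewrite ltr0n.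
pose Q := @counting_query R N N0 m1 r m0 Nm W.
pose b0 : 'I_(2 ^ q_m Q) := Ordinal (expn_gt0 2 (q_m Q) : (0 < 2 ^ q_m Q)%N).
have [U0 U0u U0i] := exists_reflection_column b0 (initial_state_unit N0 r m0 Nm W).
have [P [l [Pu Pl]]] := spectral_symmetric (counter_path_sym N0 r m0 Nm W).
pose A := counting_alg Pu U0u.
have /boolp.choice[round rnd] := @exists_nearest R N.
pose est (k : nat) := if insub k is Some k' then round (N%:R * (1 - l k') / 2) else 0%N.
exists A, est; split=> // f.
set cnt := (\sum_(i < N) W (f i))%N; set c := walk_cos (@uniform R N m1) (oracle_sign N0 W f).
have cE : c = 1 - 2 * cnt%:R / N%:R by exact: walk_cosE.
have cntN : (cnt <= N)%N.
  rewrite /cnt -[leqRHS]card_ord -sum1_card; apply: leq_sum => i _.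
  by case: (W _).
have cntR : 0 <= cnt%:R :> R by [].
pose psi := counting_state N0 r m0 Nm W f (2 ^ r).-1.
have final (k : 'I_(2 ^ q_m Q)) : entry (alg0_mx A f) k 0 = (P *m map_mx (real_complex R) psi) k 0.
  rewrite -[X in entry _ _ X]/(nat_of_ord b0) entryE /alg0_mx.
  have := counting_prod Pu U0u U0i f (leqnn (2 ^ r).-1); rewrite eqxx -/A -/psi => <-.
  by rewrite -colE mxE.
have defect := counter_path_defect N0 r m0 Nm W f.
rewrite counter_sizeE -/psi -/c in defect.
apply: (@le_trans _ _ (N%:R ^+ 2 * \sum_(k < 2 ^ q_m Q)
   sqnorm ((P *m map_mx (real_complex R) psi) k 0) * (l k - c) ^+ 2)).
  rewrite mulr_sumr; apply: ler_sum => k _; rewrite final [leRHS]mulrCA.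
  apply: ler_wpM2l; first exact: sqnorm_ge0.
  rewrite /est valK; have [tN /(_ _ cntN)] := rnd (N%:R * (1 - l k) / 2).
  set t := round _; set x := N%:R * (1 - l k) / 2 => near.
  have -> : N%:R ^+ 2 * (l k - c) ^+ 2 = (2 * (x - cnt%:R)) ^+ 2.
    by rewrite cE /x; field; rewrite gt_eqF.
  rewrite -real_normK ?num_real// -[leRHS]real_normK ?num_real//.
  rewrite ler_pXn2r ?nnegrE// normrM (ger0_norm (ler0n R 2)) mulr_natl mulr2n.
  apply: (@le_trans _ _ (`|t%:R - x| + `|x - cnt%:R|)).
    by have := ler_normD (t%:R - x) (x - cnt%:R); rewrite addrA subrK.
  by rewrite lerD2r distrC.
have -> : \sum_(k < 2 ^ q_m Q) sqnorm ((P *m map_mx (real_complex R) psi) k 0) * (l k - c) ^+ 2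
  = \sum_k ((counter_path N0 r m0 Nm W *m psi) k 0 - c * psi k 0) ^+ 2.
  pose phi := counter_path N0 r m0 Nm W *m psi - c *: psi.
  transitivity (vrip (P *m map_mx (real_complex R) phi) (P *m map_mx (real_complex R) phi)).
    have sub (X Y : 'cV[R[i]]_(2 ^ q_m Q)) a k : (X - a *: Y) k 0 = X k 0 - a * Y k 0.
      by rewrite !mxE.
    apply: eq_bigr => k _; rewrite -sqnormE /phi map_mxB map_mxM map_mxZ mulmxBr -scalemxAr.
    by rewrite sub Pl -mulrBl -rmorphB /= sqnormM sqnorm_real mulrC.
  rewrite vrip_unitary// vrip_real; apply: eq_bigr => k _.
  by rewrite -expr2 /phi !mxE.
apply: le_trans (ler_wpM2l (sqr_ge0 _) defect) _.
have Mp : 0 < (2 ^ r)%:R :> R by rewrite ltr0n expn_gt0.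
move: (2 ^ r)%:R Mp => M Mp.
have -> : N%:R ^+ 2 * (60 * (1 - c ^+ 2) / M ^+ 2 + 60 / M ^+ 4) =
   240 * N%:R * cnt%:R / M ^+ 2 + 60 * N%:R ^+ 2 / M ^+ 4 - 240 * cnt%:R ^+ 2 / M ^+ 2.
  by rewrite cE; field; rewrite !gt_eqF.
by rewrite gerBl divr_ge0 ?mulr_ge0 ?exprn_ge0 ?(ltW Mp).
Qed.

(** * Combination of the counts *)

Section IndependentStages.
Variables (R : realType) (D : finType) (K : Type) (A : alg R D K) (f : D -> K).
Hypothesis start0 : forall l s, al_b A l s = 0%N.

Lemma sum_prob_stage l : (l < al_k A)%N ->
  \sum_(y < 2 ^ alg0_qubits (al_A A l)) sqnorm (entry (alg0_mx (al_A A l) f) y 0) = 1.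
Proof.
move=> lk; rewrite -(@vrip_run _ _ _ (al_A A l) f (start lk [::]) _ (leqnn _)).
apply: eq_bigr => y _; rewrite -sqnormE.
transitivity (sqnorm (entry (alg0_mx (al_A A l) f) y (start lk [::]))).
  by rewrite /= start0.
by rewrite entryE /run -colE mxE.
Qed.

(** Every stage starts from the basis state 0, so the outcomes are independent and the other stages
    sum to 1. *)
Lemma marginal l (g : nat -> R) : (l < al_k A)%N ->
  \sum_(x <- outcomes A) prob A f x * g (nth 0%N x l) =
  \sum_(y < 2 ^ alg0_qubits (al_A A l)) sqnorm (entry (alg0_mx (al_A A l) f) y 0) * g y.
Proof.
move=> lk; rewrite (eq_bigr _ (fun x _ => congr1 (fun z => z * g (nth 0%N x l)) (probE A f x))).
suff H j : (l < j)%N -> (j <= al_k A)%N ->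
    \sum_(x <- prefixes A j) sqnorm (amplitude A f j x) * g (nth 0%N x l) =
    \sum_(y < 2 ^ alg0_qubits (al_A A l)) sqnorm (entry (alg0_mx (al_A A l) f) y 0) * g y.
  exact: H.
elim: j => // j IH; rewrite ltnS leq_eqVlt => /predU1P[<- {IH}|lj] jk.
  rewrite big_prefixesS -[RHS]mul1r -(sum_prob_prefix f (ltnW lk)) mulr_suml.
  apply: eq_big_seq => x /size_prefixes xl; rewrite mulr_sumr; apply: eq_bigr => y _.
  by rewrite amplitude_rcons// sqnormM start0 nth_rcons xl ltnn eqxx mulrA.
rewrite -IH//; last exact: ltnW.
rewrite big_prefixesS; apply: eq_big_seq => x /size_prefixes xl.
rewrite -[RHS]mulr1 -(sum_prob_stage jk) mulr_sumr; apply: eq_bigr => y _.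
by rewrite amplitude_rcons// sqnormM start0 nth_rcons xl lj mulrAC.
Qed.

End IndependentStages.

(** Cauchy-Schwarz, through the pointwise bound |d| <= (s + d^2 / s) / 2. *)
Lemma first_moment (R : realType) n (P d : 'I_n -> R) (s : R) :
  0 < s -> (forall i, 0 <= P i) -> \sum_i P i = 1 ->
  \sum_i P i * d i ^+ 2 <= s ^+ 2 -> \sum_i P i * `|d i| <= s.
Proof.
move=> s0 P0 P1 V.
have H i : P i * `|d i| <= 2^-1 * (s * P i + s^-1 * (P i * d i ^+ 2)).
  rewrite [leRHS](_ : _ = P i * (2^-1 * (s + s^-1 * d i ^+ 2))); last by ring.
  apply: ler_wpM2l => //; rewrite -[d i ^+ 2]real_normK ?num_real//.
  have := mulr_ge0 (ltW (etrans (invr_gt0 s) s0)) (sqr_ge0 (`|d i| - s)).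
  rewrite [X in _ <= X -> _](_ : _ = s^-1 * `|d i| ^+ 2 - 2 * `|d i| + s); last first.
    by field; rewrite gt_eqF.
  by lra.
apply: (le_trans (ler_sum _ (fun i _ => H i))).
rewrite -mulr_sumr big_split /= -!mulr_sumr P1 mulr1.
have : s^-1 * (\sum_i P i * d i ^+ 2) <= s.
  by rewrite mulrC ler_pdivrMr// -expr2.
by lra.
Qed.

(** Markov's inequality for the single quantity [X], the [nu]-weighted sum of all count errors,
    whose mean is at most 1/4. No stage has to be repeated to boost its success probability. *)
Lemma counting_family (R : realType) (N k : nat) (r : nat -> nat)
    (W : nat -> R -> bool) (om : nat -> R) :
  (0 < N)%N -> (0 < k)%N ->
  exists A : alg R 'I_N R, nq A = (\sum_(l < k) (2 ^ r l).-1)%N /\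
    forall (S : ('I_N -> R) -> R) (f : 'I_N -> R) (nu s : nat -> R) (eps : R),
    let cnt l := (\sum_(i < N) W l (f i))%N in
    (forall l, (l < k)%N -> [/\ 0 < s l, 0 <= nu l &
       240 * N%:R * (cnt l)%:R / (2 ^ r l)%:R ^+ 2 + 60 * N%:R ^+ 2 / (2 ^ r l)%:R ^+ 4
         <= s l ^+ 2]) ->
    \sum_(l < k) nu l * s l <= 1 / 4 ->
    (forall q : nat -> nat, \sum_(l < k) nu l * `|(q l)%:R - (cnt l)%:R| < 1 ->
       `|S f - \sum_(l < k) om l * (q l)%:R| <= eps) ->
    fail_prob S A f eps <= 1 / 4.
Proof.
move=> N0 k0.
(* N address qubits are plenty, and only queries are charged. *)
have NN : (N <= 2 ^ N)%N by apply/ltnW/ltn_expl.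
have /boolp.choice[B BP] (l : nat) : exists B : alg0 R 'I_N R * (nat -> nat),
    a_n B.1 = (2 ^ r l).-1 /\ forall f : 'I_N -> R,
      \sum_(k < 2 ^ alg0_qubits B.1)
         sqnorm (entry (alg0_mx B.1 f) k 0) * ((B.2 k)%:R - (\sum_(i < N) W l (f i))%N%:R) ^+ 2
      <= 240 * N%:R * (\sum_(i < N) W l (f i))%N%:R / (2 ^ r l)%:R ^+ 2
         + 60 * N%:R ^+ 2 / (2 ^ r l)%:R ^+ 4.
  by have [A [e H]] := counting_stage (r l) (W l) N0 N0 NN; exists (A, e).
pose A := @Alg R 'I_N R k k0 (fun l => (B l).1) (fun _ _ => 0%N)
  (fun l _ _ => expn_gt0 2 (alg0_qubits (B l).1))
  (fun x => \sum_(l < k) om l * ((B l).2 (nth 0%N x l))%:R).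
exists A; split.
  by rewrite /nq; apply: eq_bigr => l _; have [-> _] := BP l.
move=> S f nu s eps cnt hs hnu hq.
pose X (x : seq nat) := \sum_(l < k) nu l * `|((B l).2 (nth 0%N x l))%:R - (cnt l)%:R|.
have p0 x : 0 <= prob A f x by rewrite probE sqnorm_ge0.
have X0 x : 0 <= X x.
  by apply: sumr_ge0 => l _; apply: mulr_ge0 => //; have [] := hs l (ltn_ord l).
apply: (@le_trans _ _ (\sum_(x <- outcomes A) prob A f x * X x)).
  rewrite /fail_prob big_mkcond; apply: ler_sum => x _.
  case: ifPn => [bad|_]; last exact: mulr_ge0.
  rewrite -[leLHS]mulr1; apply: ler_wpM2l => //; rewrite leNgt; apply/negP => X1.
  have := hq (fun l => (B l).2 (nth 0%N x l)) X1.
  by rewrite leNgt => /negP; apply.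
apply: le_trans hnu.
under eq_bigr => x _ do rewrite mulr_sumr.
rewrite exchange_big; apply: ler_sum => l _ /=.
under eq_bigr => x _ do rewrite mulrCA.
have [s0 nu0 V] := hs l (ltn_ord l).
rewrite -mulr_sumr; apply: ler_wpM2l => //.
rewrite (@marginal _ _ _ A f (fun _ _ => erefl) l
  (fun y => `|((B l).2 y)%:R - (cnt l)%:R|) (ltn_ord l)).
apply: first_moment => //.
- by move=> i; exact: sqnorm_ge0.
- exact: (@sum_prob_stage _ _ _ A f (fun _ _ => erefl) l (ltn_ord l)).
- by apply: le_trans V; have [_ +] := BP l; apply.
Qed.

Lemma sum_bits L q : (q < 2 ^ L)%N -> (\sum_(t < L) odd (q %/ 2 ^ t) * 2 ^ t = q)%N.
Proof.
elim: L q => [|L IH] q; first by rewrite expn0 ltnS leqn0 big_ord0 => /eqP.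
move=> qL; rewrite big_ord_recl expn0 divn1 muln1.
rewrite (eq_bigr (fun t : 'I_L => 2 * (odd (q./2 %/ 2 ^ t) * 2 ^ t)))%N => [|t _].
  rewrite -big_distrr /= IH; first by rewrite mul2n odd_double_half.
  by move: qL; rewrite expnS -divn2 ltn_divLR// mulnC.
by rewrite lift0 expnS divnMA divn2 mulnCA.
Qed.

Lemma big_ord_double (V : nmodType) (F : nat -> V) L :
  \sum_(l < L.*2) F l = \sum_(t < L) (F t.*2 + F t.*2.+1).
Proof. by elim: L => [|L IH]; rewrite ?big_ord0// doubleS !big_ord_recr /= IH addrA. Qed.

Lemma sum_geometric_le (R : realFieldType) (x : R) m : 0 < x -> x < 1 ->
  \sum_(t < m) x ^+ t <= (1 - x)^-1.
Proof.
move=> x0 x1; have y0 : 0 < 1 - x by rewrite subr_gt0.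
rewrite -[leRHS]mul1r ler_pdivlMr// mulrC.
have -> : (1 - x) * \sum_(t < m) x ^+ t = 1 - x ^+ m.
  by rewrite -opprB mulNr -subrX1 opprB.
by rewrite gerBl exprn_ge0// ltW.
Qed.

Lemma sum_geometric_distn (R : realFieldType) (x : R) B m : 0 < x -> x < 1 ->
  \sum_(t < B + m) x ^+ ((t - B) + (B - t)) <= 2 / (1 - x).
Proof.
move=> x0 x1; rewrite big_split_ord /= mulr_natl mulr2n; apply: lerD.
  rewrite (reindex_inj rev_ord_inj) /=.
  apply: le_trans (sum_geometric_le B x0 x1); apply: ler_sum => t _.
  have tB := ltn_ord t.
  have -> : (B - t.+1 - B + (B - (B - t.+1)) = t.+1)%N by lia.
  by rewrite exprS ger_pMl ?exprn_gt0// ltW.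
apply: le_trans (sum_geometric_le m x0 x1); apply: ler_sum => t _.
by have -> : (B + t - B + (B - (B + t)) = t)%N by lia.
Qed.

(** For x <= 1 the choice r = 0 costs no query at all, so the factor 2 holds for arbitrarily small
    budgets. *)
Lemma exists_pow2_ge (R : realType) (x : R) : 0 <= x ->
  exists r : nat, x <= (2 ^ r)%:R /\ (2 ^ r).-1%:R <= 2 * x.
Proof.
move=> x0; have ex : exists r, x <= (2 ^ r)%:R.
  exists (Num.truncn x).+1; apply: ltW; apply: lt_trans (truncnS_gt x) _.
  by rewrite ltr_nat ltn_expl.
case: (ex_minnP ex) => -[|r] xr rmin; [exists 0%N | exists r.+1]; split=> //.
  by rewrite mulr_ge0.
have : ~~ (x <= (2 ^ r)%:R) by apply/negP => /rmin; rewrite ltnn.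
rewrite -ltNge => rx; apply: (@le_trans _ _ (2 ^ r.+1)%:R); first by rewrite ler_nat leq_pred.
by rewrite expnS natrM ler_pM2l// ltW.
Qed.

Lemma exists_expr_gt (R : realType) (x K : R) : 2 <= x ->
  exists b : nat, K < x ^+ b /\ forall a, (a < b)%N -> x ^+ a <= K.
Proof.
move=> x2; have ex : exists b, K < x ^+ b.
  exists (Num.truncn K).+1; apply: (lt_le_trans (truncnS_gt K)).
  apply: (@le_trans _ _ (2 ^+ (Num.truncn K).+1)); last by rewrite lerXn2r ?nnegrE// (le_trans _ x2).
  by rewrite -natrX ler_nat ltnW// ltn_expl.
case: (ex_minnP ex) => b Kb bmin; exists b; split=> // a ab.
by rewrite leNgt; apply: contraL ab => /bmin; rewrite -leqNgt.
Qed.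

(** * Binary digits of the function values *)

Section DyadicDigits.
Variables (R : realType) (N : nat) (p T : R) (B : nat).
Hypotheses (p1 : 1 <= p) (T0 : 0 < T).

Let p0 : 0 < p. Proof. exact: lt_le_trans p1. Qed.
Let two0 : 0 < 2 :> R. Proof. by []. Qed.

Definition dyadic_digits (v : R) : nat := Num.truncn (`|v| / T * 2 ^+ B).

(* Even indices look at the digits of nonnegative values, odd ones at those of
   negative values; a digit of position t has weight 2^(t - B). *)
Definition digit_test (l : nat) (v : R) : bool :=
  odd (dyadic_digits v %/ 2 ^ l./2) && (if odd l then v < 0 else 0 <= v).

Definition digit_weight (l : nat) : R :=
  (-1) ^+ odd l * (T / N%:R * (2 ^+ l./2 / 2 ^+ B)).

Lemma powR_exprn (x : R) t : 0 <= x -> (x ^+ t) `^ p = (x `^ p) ^+ t.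
Proof.
move=> x0; rewrite -(powR_mulrn t x0) powRAC.
exact: powR_mulrn t (powR_ge0 x p).
Qed.

Lemma powR_dyadic t : (2 ^+ t / 2 ^+ B) `^ p = (2 `^ p) ^+ t / (2 `^ p) ^+ B :> R.
Proof.
have e s : 0 <= 2 ^+ s :> R by apply: exprn_ge0.
rewrite powRM ?invr_ge0// powR_exprn//; congr (_ * _).
by rewrite -[X in X `^ _]powR_inv1// -powRrM mulrC powRrM powR_inv1 ?powR_ge0// powR_exprn.
Qed.

Lemma digits_ge t v : (2 ^ t <= dyadic_digits v)%N -> 2 ^+ t / 2 ^+ B <= `|v| / T.
Proof.
rewrite truncn_ge_nat ?mulr_ge0 ?exprn_ge0 ?invr_ge0 ?(ltW T0)// natrX => H.
by rewrite ler_pdivrMr ?exprn_gt0.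
Qed.

Variable f : 'I_N -> R.
Variable kappa : R.
Hypothesis f_sum : \sum_i (`|f i| / T) `^ p <= kappa.

Let term_le i : (`|f i| / T) `^ p <= kappa.
Proof.
apply: le_trans f_sum; rewrite (bigD1 i)//= lerDl.
by apply: sumr_ge0 => j _; exact: powR_ge0.
Qed.

(** A value whose digit at position t is 1 has size at least 2^(t - B) T, so it takes a fixed share
    of the sum [kappa]. *)
Lemma digit_count l :
  (\sum_(i < N) digit_test l (f i))%N%:R * ((2 `^ p) ^+ l./2 / (2 `^ p) ^+ B) <= kappa.
Proof.
apply: le_trans f_sum; rewrite natr_sum mulr_suml; apply: ler_sum => i _.
rewrite /digit_test; case: (boolP (odd _)) => [od|_]; last by rewrite mul0r powR_ge0.
case: (if odd l then _ else _); rewrite /= ?mul0r ?powR_ge0// mul1r -powR_dyadic.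
have e s : 0 <= 2 ^+ s :> R by apply: exprn_ge0.
rewrite ge0_ler_powR ?nnegrE ?divr_ge0 ?(ltW T0) ?(ltW p0)//.
apply: digits_ge; rewrite leqNgt; apply: contraL od => lt.
by rewrite divn_small.
Qed.

(** A single value contributes at most [kappa], hence is below 2^Btop T in size. *)
Lemma dyadic_digits_lt Btop i : kappa < (2 `^ p) ^+ Btop ->
  (dyadic_digits (f i) < 2 ^ (B + Btop))%N.
Proof.
move=> kB; rewrite ltnNge; apply/negP => /digits_ge.
rewrite exprD mulrAC mulfV ?mul1r ?expf_neq0// => H.
have := term_le i; rewrite leNgt => /negP; apply; apply: (lt_le_trans kB).
by rewrite -powR_exprn// ge0_ler_powR ?nnegrE ?divr_ge0 ?exprn_ge0 ?(ltW T0) ?(ltW p0).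
Qed.

Lemma digits_approx v : `|(-1) ^+ (v < 0)%R * (dyadic_digits v)%:R * (T / 2 ^+ B) - v| <= T / 2 ^+ B.
Proof.
have P0 : 0 < 2 ^+ B :> R by rewrite exprn_gt0.
have /truncn_itv/andP[lo hi] : 0 <= `|v| / T * 2 ^+ B by rewrite !mulr_ge0 ?invr_ge0 ?(ltW T0) ?(ltW P0).
have vE : v = (-1) ^+ (v < 0)%R * `|v|.
  by rewrite [LHS]numEsign.
rewrite [X in `|_ - X|]vE -mulrA -mulrBr normrM normrX normrN1 expr1n mul1r.
have aE : `|v| = `|v| / T * 2 ^+ B * (T / 2 ^+ B) by field; rewrite !gt_eqF.
rewrite [X in `|_ - X|]aE -mulrBl normrM [X in _ * X]gtr0_norm ?divr_gt0// ger_pMl ?divr_gt0//.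
rewrite /dyadic_digits; move: lo hi; rewrite -natr1 ler_norml.
by move: (_ / T * _) => a lo hi; apply/andP; split; lra.
Qed.

(** With exact counts only the truncation of each value to [B] binary places remains. *)
Lemma digits_sum L : (0 < N)%N -> (forall i, dyadic_digits (f i) < 2 ^ L)%N ->
  `|SN R N f - \sum_(l < L.*2) digit_weight l * (\sum_(i < N) digit_test l (f i))%N%:R|
    <= T / 2 ^+ B.
Proof.
move=> N0 fL; have NR : 0 < N%:R :> R by rewrite ltr0n.
have P0 : 0 < 2 ^+ B :> R by rewrite exprn_gt0.
have E i : (dyadic_digits (f i))%:R =
    \sum_(t < L) (odd (dyadic_digits (f i) %/ 2 ^ t) * 2 ^ t)%N%:R :> R.
  by rewrite -natr_sum sum_bits.
have -> : \sum_(l < L.*2) digit_weight l * (\sum_(i < N) digit_test l (f i))%N%:R =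
    N%:R^-1 * \sum_i ((-1) ^+ (f i < 0)%R * (dyadic_digits (f i))%:R * (T / 2 ^+ B)).
  rewrite (big_ord_double (fun l => digit_weight l * (\sum_(i < N) digit_test l (f i))%N%:R)).
  rewrite mulr_sumr; under [RHS]eq_bigr => i _.
    rewrite E !(mulr_sumr, mulr_suml); over.
  rewrite exchange_big; apply: eq_bigr => t _ /=.
  rewrite !natr_sum !mulr_sumr -big_split; apply: eq_bigr => i _ /=.
  rewrite /digit_weight /digit_test /= uphalf_double doubleK odd_double /=.
  rewrite natrM natrX ltNge.
  by case: (odd (_ %/ _)); case: (0 <= f i); rewrite /=; field; rewrite !gt_eqF.
rewrite /SN -mulrBr normrM gtr0_norm ?invr_gt0// mulrC ler_pdivrMr// -sumrB.
apply: le_trans (ler_norm_sum _ _ _) _.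
apply: (@le_trans _ _ (\sum_(i < N) T / 2 ^+ B)).
  by apply: ler_sum => i _; rewrite distrC; exact: digits_approx.
by rewrite sumr_const card_ord mulr_natr.
Qed.

End DyadicDigits.

(** * Query budgets and the upper bound *)

Lemma exponent_constants (R : realType) (p : R) : 1 <= p < 2 ->
  exists rho q : R, [/\ 0 < rho, rho < 1 & [/\ 0 < q, q ^+ 2 * 2 `^ p = 1,
    q * rho ^+ 2 = 2^-1 & q <= rho ^+ 2]].
Proof.
move=> /andP[p1 p2]; have two0 : (2 : R) != 0 by [].
have DE (x y : R) : 2 `^ x * 2 `^ y = 2 `^ (x + y) :> R by rewrite powRD// two0 implybT.
have rho2 : (2 `^ (- ((2 - p) / 4))) ^+ 2 = 2 `^ (- ((2 - p) / 2)) :> R.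
  by rewrite expr2 DE; congr (_ `^ _); field.
(* [rho] is the decay of the budgets per digit, below 1 because p < 2; [q] is the root of the decay
   2^(-p) of the count bound. Digits below the threshold use q rho^2 = 1/2, as their weights halve;
   those above use q <= rho^2, which amounts to p >= 1. *)
exists (2 `^ (- ((2 - p) / 4))), (2 `^ (- (p / 2))); split; first exact: powR_gt0.
  rewrite powRN invf_lt1 ?powR_gt0// [ltLHS](_ : _ = 1 `^ ((2 - p) / 4)); last by rewrite powR1.
  by rewrite gt0_ltr_powR ?nnegrE ?ltr1n// divr_gt0// subr_gt0.
split; first exact: powR_gt0.
- by rewrite expr2 !DE (_ : _ + p = 0) ?powRr0//; field.
- by rewrite rho2 DE -[RHS]powR_inv1//; congr (_ `^ _); field.
- by rewrite rho2 ler_powR ?ler1n//; lra.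
Qed.

(** Here [a] is rho^e at distance e from the threshold. The hypotheses on [nu] leave a factor [a]
    after division by M and M^2, so that the weighted deviations are dominated by a geometric
    series. *)
Lemma level_bound (R : realFieldType) (eta om a n N M nu u : R) :
  0 < eta -> 0 < om -> om <= 1 -> 0 < a -> a <= 1 -> 0 < n -> 0 <= nu -> 0 <= u ->
  0 <= N ->
  eta * n * a <= M -> nu * u <= a ^+ 2 -> nu * N <= (eta * om) ^+ 2 * n ^+ 2 * a ^+ 4 ->
  nu * (16 * (eta * om) * n * u / M + 8 * N / M ^+ 2) <= 24 * om * a.
Proof.
move=> eta0 om0 om1 a0 a1 n0 nu0 u0 N0 XM h1 h2.
have X0 : 0 < eta * n * a by rewrite !mulr_gt0.
have M0 : 0 < M by apply: lt_le_trans XM.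
apply: (@le_trans _ _ (16 * om * a + 8 * om * a)); last by lra.
rewrite mulrDr; apply: lerD.
  rewrite mulrA ler_pdivrMr//.
  apply: (@le_trans _ _ (16 * om * a * (eta * n * a))); last by rewrite ler_pM2l ?mulr_gt0.
  rewrite [leLHS](_ : _ = (16 * (eta * om) * n) * (nu * u)); last by ring.
  rewrite [leRHS](_ : _ = (16 * (eta * om) * n) * a ^+ 2); last by ring.
  by rewrite ler_pM2l ?mulr_gt0.
rewrite mulrA ler_pdivrMr ?exprn_gt0//.
apply: (@le_trans _ _ (8 * om * a * (eta * n * a) ^+ 2)); last first.
  by rewrite ler_pM2l ?mulr_gt0// ler_pXn2r ?nnegrE ?(ltW X0) ?(ltW M0).
rewrite [leLHS](_ : _ = 8 * (nu * N)); last by ring.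
rewrite [leRHS](_ : _ = 8 * (om * a * (eta * n * a) ^+ 2)); last by ring.
rewrite ler_pM2l//; apply: le_trans h2 _.
rewrite [leLHS](_ : _ = (om * a) * (om * a * (eta * n * a) ^+ 2)); last by ring.
by rewrite ger_pMl ?mulr_gt0 ?exprn_gt0 ?mulr_gt0// mulr_ile1// ltW.
Qed.

(** The count bound is proportional to 1/y and [u] is the root of 1/y; the constants 16 and 8 exceed
    the roots of 240 and 60. *)
Lemma stage_variance (R : realFieldType) (g n N M u c y : R) :
  0 < g -> 0 < n -> 0 < N -> 0 < M -> 0 < u -> u ^+ 2 * y = 1 -> 
  c * y <= g ^+ 2 * n ^+ 2 / N ->
  240 * N * c / M ^+ 2 + 60 * N ^+ 2 / M ^+ 4 <= (16 * g * n * u / M + 8 * N / M ^+ 2) ^+ 2.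
Proof.
move=> g0 n0 N0 M0 u0 uy; rewrite ler_pdivlMr// => h.
have Nc : N * c <= g ^+ 2 * n ^+ 2 * u ^+ 2.
  have := ler_wpM2r (sqr_ge0 u) h.
  by rewrite [X in X <= _ -> _](_ : _ = N * c * (u ^+ 2 * y)); [rewrite uy mulr1 | ring].
have M2 : 0 < (M ^+ 2)^-1 by rewrite invr_gt0 exprn_gt0.
have A : 240 * N * c / M ^+ 2 <= (16 * g * n * u / M) ^+ 2.
  rewrite [leRHS](_ : _ = 256 * (g ^+ 2 * n ^+ 2 * u ^+ 2) / M ^+ 2); last by field; rewrite gt_eqF.
  rewrite ler_pM2r// -mulrA; have : 0 <= (g * n * u) ^+ 2 by apply: sqr_ge0.
  by rewrite !exprMn; lra.
have B : 60 * N ^+ 2 / M ^+ 4 <= (8 * N / M ^+ 2) ^+ 2.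
  rewrite [leRHS](_ : _ = 64 * N ^+ 2 / M ^+ 4); last by field; rewrite gt_eqF.
  rewrite ler_pM2r ?invr_gt0 ?exprn_gt0// ler_pM2r ?exprn_gt0//.
  by rewrite ler_nat.
have P : 0 <= (16 * g * n * u / M) * (8 * N / M ^+ 2).
  by rewrite !mulr_ge0 ?invr_ge0 ?exprn_ge0// ltW.
by rewrite sqrrD; lra.
Qed.

Lemma min_query_err_le (R : realType) D K (S : (D -> K) -> R) (F : set (D -> K)) n
    (A : alg R D K) (eps : R) : (nq A <= n)%N ->
  (forall f, F f -> fail_prob S A f eps <= 1 / 4) ->
  (min_query_err R D K S F n <= eps%:E)%E.
Proof.
move=> An Af; apply: (@le_trans _ _ (err S F A)).
  by apply: ereal_inf_lbound; exists A.
apply: ge_ereal_sup => _ [f /= fF <-].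
by apply: ereal_inf_lbound; exists eps => //; exact: Af.
Qed.

Lemma ball_sum (R : realType) (p : R) N (f : 'I_N -> R) : 1 <= p -> (0 < N)%N ->
  BpN R N p f -> \sum_i `|f i| `^ p <= N%:R.
Proof.
move=> p1 N0; rewrite /BpN /= /LpN_norm; set s := \sum_i _ => h.
have p0 : 0 < p by apply: lt_le_trans p1.
have NR : 0 < N%:R :> R by rewrite ltr0n.
have s0 : 0 <= s by apply: sumr_ge0 => i _; exact: powR_ge0.
have x0 : 0 <= N%:R^-1 * s by rewrite mulr_ge0 ?invr_ge0.
have : ((N%:R^-1 * s) `^ p^-1) `^ p <= 1 `^ p.
  by rewrite ge0_ler_powR ?nnegrE ?powR_ge0// ltW.
rewrite powR1 -powRrM mulVf ?gt_eqF// powRr1//.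
by rewrite mulrC ler_pdivrMr// mul1r.
Qed.

(** No logarithm appears: budgets and weighted deviations both sum as geometric series in the
    distance of a digit to the threshold. *)
Lemma upper_bound (R : realType) (p : R) : 1 <= p < 2 ->
  exists g : R, 0 < g /\ forall n N, (0 < n)%N -> (0 < N)%N ->
    g^-1 * Num.sqrt N%:R <= n%:R ->
    (min_query_err R ('I_N) R (SN R N) (BpN R N p) n <=
     (2 * g `^ (- (2 / p)) * n%:R `^ (- (2 / p)) * N%:R `^ (2 / p - 1))%:E)%E.
Proof.
move=> p12; have /andP[p1 p2] := p12.
have [rho [q [rho0 rho1 [q0 qy qrho q_le]]]] := exponent_constants p12.
have p0 : 0 < p by apply: lt_le_trans p1.
have d0 : 0 < 1 - rho by rewrite subr_gt0.
(* Over both sides of the threshold and both signs the powers of [rho] sum to at most 4 / (1 - rho).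
   So [eta] limits the queries to n, and [om] the mean weighted error to 1/4. *)
pose eta := (1 - rho) / 8; pose om := (1 - rho) / 8 / 8 / 6.
have eta0 : 0 < eta by rewrite divr_gt0.
have om0 : 0 < om by rewrite /om; lra.
have om1 : om <= 1 by rewrite /om; lra.
have [g gE] : exists g, g = eta * om by exists (eta * om).
have g0 : 0 < g by rewrite gE mulr_gt0.
exists g; split=> // n N n0 N0 nN.
have nR : 0 < n%:R :> R by rewrite ltr0n.
have NR : 0 < N%:R :> R by rewrite ltr0n.
have Nle : N%:R <= g ^+ 2 * n%:R ^+ 2.
  rewrite -exprMn -[leLHS]sqr_sqrtr ?ler0n// ler_pXn2r ?nnegrE ?sqrtr_ge0//.
    by rewrite -ler_pdivrMl.
  by rewrite mulr_ge0// ltW.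
(* [kappa] bounds the sum of the (|f i| / T)^p over the ball, hence also the number of values of
   size at least [T]. *)
pose kappa := g ^+ 2 * n%:R ^+ 2 / N%:R.
pose T := (N%:R ^+ 2 / (g * n%:R) ^+ 2) `^ p^-1.
have gn0 : 0 < g * n%:R by rewrite mulr_gt0.
have T0 : 0 < T by apply: powR_gt0; rewrite divr_gt0 ?exprn_gt0.
have -> : 2 * g `^ (- (2 / p)) * n%:R `^ (- (2 / p)) * N%:R `^ (2 / p - 1) = 2 * (T / N%:R).
  by rewrite (powR_scale p NR gn0) powRM ?(ltW g0) ?ler0n//; ring.
set y := 2 `^ p in qy.
have y2 : 2 <= y by rewrite /y -[leLHS]powRr1// ler_powR// ler1n.
have y0 : 0 < y by apply: lt_le_trans y2.
have [Btop [kB Bmin]] := exists_expr_gt kappa y2.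
have /boolp.choice[r rP] (e : nat) : exists r : nat,
    eta * n%:R * rho ^+ e <= (2 ^ r)%:R /\ (2 ^ r).-1%:R <= 2 * (eta * n%:R * rho ^+ e).
  by apply: exists_pow2_ge; rewrite !mulr_ge0 ?exprn_ge0 ?ltW.
(* N digits below [T] push the truncation error under T/N, and [Btop] digits above reach every
   value; [e t] is the distance of position t to [T]. *)
pose L := (N + Btop)%N; pose e t := ((t - N) + (N - t))%N.
have L0 : (0 < L.*2)%N by rewrite double_gt0 addn_gt0 N0.
have [A [nqA HA]] := @counting_family R N L.*2 (fun l => r (e l./2)) (digit_test T N)
  (digit_weight N T N) N0 L0.
have sum_rho (a : R) : 0 <= a ->
    \sum_(l < L.*2) a * rho ^+ e l./2 <= a * (4 / (1 - rho)).
  move=> a0; rewrite -mulr_sumr ler_wpM2l//.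
  rewrite (big_ord_double (fun l => rho ^+ e l./2)).
  under eq_bigr => t _ do rewrite /= doubleK uphalf_double.
  rewrite big_split /= -mulr2n -[leLHS]mulr_natl.
  have := @sum_geometric_distn _ rho N Btop rho0 rho1; rewrite -/L.
  have -> : 4 / (1 - rho) = 2 * (2 / (1 - rho)) by field; rewrite gt_eqF.
  by rewrite ler_pM2l.
apply: (min_query_err_le (A := A)) => [|f fB].
  rewrite nqA -(ler_nat R) natr_sum.
  apply: (@le_trans _ _ (\sum_(l < L.*2) (2 * (eta * n%:R)) * rho ^+ e l./2)).
    by apply: ler_sum => l _; have [_] := rP (e l./2); rewrite !mulrA.
  apply: le_trans (sum_rho _ _) _; first by rewrite !mulr_ge0 ?ltW.
  by rewrite le_eqVlt; apply/orP; left; apply/eqP; rewrite /eta; field; rewrite gt_eqF.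
have f_sum : \sum_i (`|f i| / T) `^ p <= kappa.
  have Tp : (T^-1) `^ p = (g * n%:R) ^+ 2 / N%:R ^+ 2.
    rewrite -[T^-1]powR_inv1 ?(ltW T0)// -powRrM mulN1r powRN /T -powRrM mulVf ?gt_eqF//.
    by rewrite powRr1 ?invf_div// divr_ge0 ?sqr_ge0.
  rewrite (eq_bigr (fun i => `|f i| `^ p * ((g * n%:R) ^+ 2 / N%:R ^+ 2))) => [|i _].
    rewrite -mulr_suml; apply: (@le_trans _ _ (N%:R * ((g * n%:R) ^+ 2 / N%:R ^+ 2))).
      by rewrite ler_wpM2r ?ball_sum// divr_ge0 ?sqr_ge0.
    by rewrite le_eqVlt; apply/orP; left; apply/eqP; rewrite /kappa; field; rewrite gt_eqF.
  by rewrite powRM ?invr_ge0 ?(ltW T0)// Tp.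
pose u t := q ^+ t / q ^+ N.
(* Below [T] a count error weighs as much as it moves the result, in units of T/N. Above, the weight
   1 makes a total below 1 force exact counts. *)
pose nu l : R := if (l./2 < N)%N then 2 ^+ l./2 / 2 ^+ N else 1.
pose M l : R := (2 ^ r (e l./2))%:R.
pose s l := 16 * g * n%:R * u l./2 / M l + 8 * N%:R / M l ^+ 2.
have M0 l : 0 < M l by rewrite ltr0n expn_gt0.
have u0 t : 0 < u t by rewrite divr_gt0 ?exprn_gt0.
have nu0 l : 0 <= nu l by rewrite /nu; case: ifP => _ //; rewrite divr_ge0 ?exprn_ge0.
have s0 l : 0 < s l.
  apply: addr_gt0; apply: divr_gt0 => //; rewrite ?exprn_gt0//.
    by rewrite mulr_gt0 ?u0// mulr_gt0// mulr_gt0.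
  by rewrite mulr_gt0.
apply: (HA _ _ nu s).
- move=> l lL; split=> //.
  apply: (@stage_variance _ g n%:R N%:R (M l) (u l./2) _ (y ^+ l./2 / y ^+ N)) => //.
    rewrite /u expr_div_n mulrACA -invfM -!exprM (mulnC _ 2%N) (mulnC _ 2%N) !exprM.
    by rewrite -!exprMn qy !expr1n divr1.
  exact: digit_count.
- apply: (@le_trans _ _ (\sum_(l < L.*2) (24 * om) * rho ^+ e l./2)).
    apply: ler_sum => l _.
    have re0 : 0 < rho ^+ e l./2 by apply: exprn_gt0.
    have re1 : rho ^+ e l./2 <= 1 by rewrite exprn_ile1// ltW.
    have qe j : q ^+ j <= (rho ^+ j) ^+ 2.
      by rewrite -exprM mulnC exprM lerXn2r ?nnegrE ?exprn_ge0 ?(ltW q0) ?(ltW rho0).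
    have [nu_u nu_N] : nu l * u l./2 <= (rho ^+ e l./2) ^+ 2 /\
        nu l * N%:R <= g ^+ 2 * n%:R ^+ 2 * (rho ^+ e l./2) ^+ 4.
      rewrite /nu /u /e; case: ltnP => tN.
        have -> : (l./2 - N + (N - l./2) = N - l./2)%N by move: tN; clear; lia.
        rewrite -[in 2 ^+ N](subnK (ltnW tN)) -[in q ^+ N](subnK (ltnW tN)) !exprD.
        move: (N - l./2)%N => j; set t := l./2.
        (* The halving of the weights pays for the growth q^(-j) of the deviation and leaves
           rho^(2j). *)
        have key : (2 ^+ j)^-1 = q ^+ j * (rho ^+ j) ^+ 2.
          by rewrite -exprM mulnC exprM -exprMn qrho exprVn.
        have -> : 2 ^+ t / (2 ^+ j * 2 ^+ t) = (2 ^+ j)^-1 :> R.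
          by field; rewrite !expf_neq0.
        have -> : q ^+ t / (q ^+ j * q ^+ t) = (q ^+ j)^-1.
          by field; rewrite !expf_neq0 ?gt_eqF.
        rewrite key mulrAC mulfV ?expf_neq0 ?gt_eqF// mul1r; split=> //.
        rewrite [leRHS](_ : _ = (rho ^+ j) ^+ 2 * (rho ^+ j) ^+ 2 * (g ^+ 2 * n%:R ^+ 2)); last by ring.
        apply: ler_pM => //; first by rewrite mulr_ge0 ?exprn_ge0 ?(ltW q0) ?(ltW rho0).
        by rewrite ler_pM2r ?exprn_gt0.
      have jB : (l./2 - N < Btop)%N.
        have lL : (l < L.*2)%N := ltn_ord l.
        by move: tN lL; rewrite /L -ltn_half_double; clear; lia.
      have -> : (l./2 - N + (N - l./2) = l./2 - N)%N by move: tN; clear; lia.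
      rewrite !mul1r -[in q ^+ l./2](subnK tN) exprD mulfK ?expf_neq0 ?gt_eqF//.
      (* Minimality of [Btop] gives (2^p)^j <= kappa, that is N <= g^2 n^2 q^(2j). *)
      move: (l./2 - N)%N jB => j /Bmin jk; split=> //.
      have qyj : (q ^+ j) ^+ 2 * y ^+ j = 1 by rewrite -exprM mulnC exprM -exprMn qy expr1n.
      have NN : N%:R <= g ^+ 2 * n%:R ^+ 2 * (q ^+ j) ^+ 2.
        move: jk; rewrite /kappa ler_pdivlMr// => /(ler_wpM2r (sqr_ge0 (q ^+ j))).
        by rewrite [X in X <= _ -> _](_ : _ = N%:R * ((q ^+ j) ^+ 2 * y ^+ j)); [rewrite qyj mulr1 | ring].
      apply: le_trans NN _; rewrite ler_pM2l ?mulr_gt0 ?exprn_gt0//.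
      by rewrite (exprM _ 2 2) lerXn2r ?nnegrE ?exprn_ge0 ?(ltW q0) ?(ltW rho0).
    rewrite /s; rewrite gE in nu_N *; apply: (@level_bound _ eta om (rho ^+ e l./2) n%:R N%:R (M l)) => //.
      exact: ltW (u0 _).
    by have [] := rP (e l./2).
  apply: le_trans (sum_rho _ _) _; first by rewrite mulr_ge0 ?(ltW om0).
  by rewrite le_eqVlt; apply/orP; left; apply/eqP; rewrite /om; field; rewrite gt_eqF.
move=> Q hQ.
have fL i : (dyadic_digits T N (f i) < 2 ^ L)%N by apply: (dyadic_digits_lt N p1 T0 f_sum).
have P0 : 0 < 2 ^+ N :> R by rewrite exprn_gt0.
have D := digits_sum T0 N0 fL.
set c := fun l => (\sum_(i < N) digit_test T N l (f i))%N in D hQ.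
have TN0 : 0 < T / N%:R by rewrite divr_gt0.
have DN : T / 2 ^+ N <= T / N%:R.
  by rewrite ler_pM2l// lef_pV2 ?posrE// -natrX ler_nat ltnW// ltn_expl.
have E : `|\sum_(l < L.*2) digit_weight N T N l * (Q l)%:R
          - \sum_(l < L.*2) digit_weight N T N l * (c l)%:R| <= T / N%:R.
  rewrite -sumrB; apply: le_trans (ler_norm_sum _ _ _) _.
  apply: (@le_trans _ _ (\sum_(l < L.*2) T / N%:R * (nu l * `|(Q l)%:R - (c l)%:R|))); last first.
    by rewrite -mulr_sumr -[leRHS]mulr1 ler_pM2l// ltW.
  apply: ler_sum => l _; rewrite -mulrBr normrM /digit_weight.
  rewrite normrM normrX normrN1 expr1n mul1r gtr0_norm; last by rewrite mulr_gt0// divr_gt0 ?exprn_gt0.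
  rewrite -[leLHS]mulrA ler_pM2l// /nu; case: ltnP => // tN.
  (* Above the threshold the error of a count is an integer below 1, hence zero. *)
  have small : `|(Q l)%:R - (c l)%:R| < 1 :> R.
    apply: le_lt_trans hQ; rewrite (bigD1 l)//= {1}/nu ltnNge tN /= mul1r lerDl.
    by apply: sumr_ge0 => l' _; apply: mulr_ge0.
  suff -> : Q l = c l by rewrite subrr normr0 !mulr0.
  apply/eqP; move: small; apply: contraTT; rewrite neq_ltn -leNgt => /orP[lt|lt].
    by rewrite distrC; apply: le_trans (ler_norm _); rewrite -natrB ?ler1n ?subn_gt0 // ltnW.
  by apply: le_trans (ler_norm _); rewrite -natrB ?ler1n ?subn_gt0 // ltnW.
(* The truncation error and the counting error are each at most T/N. *)
have := ler_normD (SN R N f - \sum_(l < L.*2) digit_weight N T N l * (c l)%:R)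
  (\sum_(l < L.*2) digit_weight N T N l * (c l)%:R
   - \sum_(l < L.*2) digit_weight N T N l * (Q l)%:R).
rewrite addrA subrK [`|\sum_(l < _) _ - _|]distrC; move: D DN E.
by lra.
Qed.

Theorem theorem2 (R : realType) (p : R) :
  1 <= p < 2 ->
  exists c0 c1 c2 c3 : R,
    0 < c0 /\ 0 < c1 /\ 0 < c2 /\ 0 < c3 /\
    forall n N : nat, (0 < n)%N -> (0 < N)%N ->
      c0 * Num.sqrt N%:R <= n%:R <= c1 * N%:R ->
      ((c2 * n%:R `^ (- (2 / p)) * N%:R `^ (2 / p - 1))%:E
         <= min_query_err R ('I_N) R (SN R N) (BpN R N p) n)%E /\
      (min_query_err R ('I_N) R (SN R N) (BpN R N p) n
         <= (c3 * n%:R `^ (- (2 / p)) * N%:R `^ (2 / p - 1)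
             * Num.max (log2 R (n%:R / Num.sqrt N%:R)) 1 `^ (2 / p - 1))%:E)%E.
Proof.
move=> p12; have /andP[p1 p2] := p12.
have [g [g0 up]] := upper_bound p12.
have c00 : 0 < g^-1 by rewrite invr_gt0.
have C0 : 0 < 1024 + g^-1^-1 ^+ 2 :> R.
  by apply: ltr_wpDr; [exact: sqr_ge0 | rewrite ltr0n].
exists g^-1, 64^-1, ((1024 + g^-1^-1 ^+ 2) `^ (- p^-1) / 4), (2 * g `^ (- (2 / p))).
split; first exact: c00.
split; first by rewrite invr_gt0 ltr0n.
split; first by rewrite divr_gt0 ?powR_gt0.
split; first by rewrite mulr_gt0 ?powR_gt0.
move=> n N n0 N0 nN; split.
  exact: (@lower_bound R p p1 g^-1 n N c00 n0 N0 nN).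
have /andP[nN1 _] := nN; apply: le_trans (up n N n0 N0 nN1) _.
(* The maximum is at least 1 and its exponent nonnegative, so the logarithmic factor only weakens
   the bound. *)
rewrite lee_fin ler_peMr ?mulr_ge0 ?powR_ge0//.
have e0 : 0 <= 2 / p - 1 by rewrite subr_ge0 ler_pdivlMr ?mul1r ?ltW// (lt_le_trans _ p1).
rewrite [leLHS](_ : _ = 1 `^ (2 / p - 1)); last by rewrite powR1.
by rewrite ge0_ler_powR ?nnegrE ?le_max ?ler01 ?lexx ?orbT.
Qed.
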